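(* Suppose that incremental or decremental $s$-$t$ Shortest Paths can be maintained with $P(m)$ preprocessing time and $u(m)$ amortized update and query time, where $m$ is the number of edges. Then OMv3 on $n\times n$ matrices can be solved with $P(O(n^2))$ preprocessing time and $n^2\cdot u(O(n^2))$ total query time.
   Context: OMv3 problem: given an $n\times n$ Boolean matrix $A$ that may be preprocessed, answer $n$ queries online, where each query consists of three length-$n$ Boolean vectors $u,v,w$, and the answer must be the Boolean value $\bigvee_{i,j,k}(u_i\wedge v_j\wedge w_k\wedge A[i,j]\wedge A[j,k]\wedge A[k,i])$, output before the next query is given. In incremental (resp. decremental) $s$-$t$ Shortest Paths, an unweighted graph undergoes only edge insertions (resp. deletions), two vertices $s,t$ are fixed, and queries ask for the current shortest-path distance from $s$ to $t$. *)

(* Defs.v *)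
From HB Require Import structures.
From mathcomp Require Import all_boot all_algebra.
Set Implicit Arguments.
Unset Strict Implicit.
Unset Printing Implicit Defensive.

(** * Word RAM

    Running times are measured on a deterministic word RAM with word length
    [w].  A program is a fixed finite text, independent of the instance and of
    [w], over finitely many registers and finitely many word-indexed arrays
    (finitely many arrays simulate, and are simulated by, a single memory with
    constant overhead).  Every operation on words costs one unit. *)

Inductive binop :=
  | Add | Sub | Mul | Div | Mod | And | Or | Xor | Shl | Shr | Eq | Lt.

(* Registers and arrays are named by natural numbers.  A word is true in [If]
   and [While] when it is nonzero. *)
Inductive cmd :=
  | Skip
  | Const of nat & nat              (* x := k *)
  | Op of nat & binop & nat & nat   (* x := y op z *)
  | Read of nat & nat & nat         (* x := a[y] *)
  | Write of nat & nat & nat        (* a[x] := y *)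
  | Seq of cmd & cmd
  | If of nat & cmd & cmd
  | While of nat & cmd.

Record state := State { reg : nat -> nat; arr : nat -> nat -> nat }.

Definition state0 : state := State (fun=> 0) (fun _ _ => 0).

Definition wrap (w x : nat) : nat := x %% 2 ^ w.

Definition eval_binop (w : nat) (o : binop) (x y : nat) : nat :=
  wrap w match o with
         | Add => x + y
         | Sub => x + (2 ^ w - y)
         | Mul => x * y
         | Div => x %/ y
         | Mod => x %% y
         | And => Nat.land x y
         | Or => Nat.lor x y
         | Xor => Nat.lxor x y
         | Shl => x * 2 ^ y
         | Shr => x %/ 2 ^ y
         | Eq => x == y
         | Lt => x < y
         end.

Definition set_reg (x v : nat) (st : state) : state :=
  State (fun y => if y == x then v else reg st y) (arr st).

Definition set_arr (a i v : nat) (st : state) : state :=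
  State (reg st)
    (fun b j => if (b == a) && (j == i) then v else arr st b j).

(* [runs w c st t st']: started in [st], [c] halts in [st'] after [t] steps. *)
Inductive runs (w : nat) : cmd -> state -> nat -> state -> Prop :=
  | runs_skip st : runs w Skip st 1 st
  | runs_const x k st : runs w (Const x k) st 1 (set_reg x (wrap w k) st)
  | runs_op x o y z st :
      runs w (Op x o y z) st 1
        (set_reg x (eval_binop w o (reg st y) (reg st z)) st)
  | runs_read x a y st :
      runs w (Read x a y) st 1 (set_reg x (arr st a (reg st y)) st)
  | runs_write a x y st :
      runs w (Write a x y) st 1 (set_arr a (reg st x) (reg st y) st)
  | runs_seq c1 c2 st t1 st1 t2 st2 :
      runs w c1 st t1 st1 -> runs w c2 st1 t2 st2 ->
      runs w (Seq c1 c2) st (t1 + t2) st2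
  | runs_if x c1 c2 st t st' :
      runs w (if reg st x != 0 then c1 else c2) st t st' ->
      runs w (If x c1 c2) st t.+1 st'
  | runs_while_end x c st : reg st x = 0 -> runs w (While x c) st 1 st
  | runs_while_step x c st t1 st1 t2 st2 :
      reg st x != 0 -> runs w c st t1 st1 -> runs w (While x c) st1 t2 st2 ->
      runs w (While x c) st (t1 + t2).+1 st2.

(** * Interactive algorithms

    An input is a list of words.  It is handed over in array 0, its length in
    register 0; the rest of the memory is left as the previous call left it.
    The output is read off register 1. *)

Definition with_input (w : nat) (inp : seq nat) (st : state) : state :=
  State (fun y => if y == 0 then wrap w (size inp) else reg st y)
    (fun b j => if (b == 0) && (j < size inp) then wrap w (nth 0 inp j)
                else arr st b j).

Definition output (st : state) : nat := reg st 1.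

(* Receiving the input is charged one step per word, plus one step for the
   call, so that no procedure runs in less time than its input length. *)
Definition call (w : nat) (c : cmd) (inp : seq nat) (st : state) (t : nat)
    (st' : state) : Prop :=
  exists2 t', t = (size inp).+1 + t' & runs w c (with_input w inp st) t' st'.

(* [serves w proc enc next ok a qs st T]: from memory [st], the requests [qs]
   are answered one after the other in total time [T].  [a] is the abstract
   state of the problem instance, [next] its evolution, and [ok a q r] says
   that [r] is an acceptable output for request [q]. *)
Inductive serves (A Q : Type) (w : nat) (proc : Q -> cmd) (enc : Q -> seq nat)
    (next : A -> Q -> A) (ok : A -> Q -> nat -> Prop) :
    A -> seq Q -> state -> nat -> Prop :=
  | serves_nil a st : serves w proc enc next ok a [::] st 0
  | serves_cons a q qs st t st' T :
      call w (proc q) (enc q) st t st' -> ok a q (output st') ->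
      serves w proc enc next ok (next a q) qs st' T ->
      serves w proc enc next ok a (q :: qs) st (t + T).

(** * Partially dynamic s-t Shortest Paths *)

Inductive mode := Incremental | Decremental.

(* A graph on the vertices 0, ..., N-1 is a duplicate-free list of pairs.  An
   edge of an undirected graph is listed once, smaller endpoint first. *)
Definition is_edge (directed : bool) (N : nat) (e : nat * nat) : bool :=
  [&& e.1 < N, e.2 < N & if directed then e.1 != e.2 else e.1 < e.2].

Definition is_graph (directed : bool) (N : nat) (E : seq (nat * nat)) : bool :=
  all (is_edge directed N) E && uniq E.

Definition adj (directed : bool) (E : seq (nat * nat)) : rel nat :=
  fun a b => ((a, b) \in E) || (~~ directed && ((b, a) \in E)).

Definition walk (directed : bool) (E : seq (nat * nat)) (s t l : nat) : Prop :=
  exists p : seq nat,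
    [/\ path (adj directed E) s p, last s p = t & size p = l].

Definition is_dist (directed : bool) (E : seq (nat * nat)) (s t d : nat) :
    Prop :=
  walk directed E s t d /\ forall l, walk directed E s t l -> d <= l.

(* Finite distances are less than [N]; the output [N] stands for infinity. *)
Definition dist_answer (directed : bool) (N s t : nat) (E : seq (nat * nat))
    (r : nat) : Prop :=
  is_dist directed E s t r \/
  (r = N /\ forall l, ~ walk directed E s t l).

Inductive request := Update of nat * nat | Query.

Definition next_graph (md : mode) (E : seq (nat * nat)) (q : request) :
    seq (nat * nat) :=
  match q, md with
  | Update e, Incremental => e :: E
  | Update e, Decremental => rem e E
  | Query, _ => E
  end.

Definition request_ok (directed : bool) (N s t : nat) (E : seq (nat * nat))
    (q : request) (r : nat) : Prop :=
  if q is Query then dist_answer directed N s t E r else True.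

Fixpoint legal (directed : bool) (md : mode) (N m : nat) (E : seq (nat * nat))
    (qs : seq request) : bool :=
  if qs is q :: qs' then
    match q, md with
    | Update e, Incremental =>
        [&& is_edge directed N e, e \notin E & size E < m]
    | Update e, Decremental => e \in E
    | Query, _ => true
    end && legal directed md N m (next_graph md E q) qs'
  else true.

(* [m] is the number of edges of the largest graph of the sequence: the number
   of initial edges in the decremental case, an upper bound on the number of
   final edges in the incremental case.  Since the time bounds depend on [m]
   only, the number of vertices is at most that of a connected graph with [m]
   edges. *)
Definition is_instance (directed : bool) (md : mode) (N m s t : nat)
    (E : seq (nat * nat)) (qs : seq request) : bool :=
  [&& is_graph directed N E, s < N, t < N, N <= m.+1,
      (if md is Incremental then size E <= m else size E == m)
    & legal directed md N m E qs].

Definition edge_words (e : nat * nat) : seq nat := [:: e.1; e.2].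

Definition graph_words (N m s t : nat) (E : seq (nat * nat)) : seq nat :=
  [:: N; m; s; t] ++ flatten [seq edge_words e | e <- E].

Definition request_words (q : request) : seq nat :=
  if q is Update e then edge_words e else [::].

Record sp_algorithm :=
  SPAlgorithm { sp_prep : cmd; sp_update : cmd; sp_query : cmd }.

Definition sp_proc (D : sp_algorithm) (q : request) : cmd :=
  if q is Update _ then sp_update D else sp_query D.

(* Preprocessing time O(P(m)) and amortized time O(u(m)) per update and query,
   on every word length w >= kappa * log2 (m + 2).  As usual for partially
   dynamic problems, the cost of the at most [m] updates that the whole
   sequence can contain may be incurred early: k requests take O((m + k) u(m))
   time.  This is implied by a bound of O(k u(m)). *)
Definition maintains_stSP (directed : bool) (md : mode) (P u : nat -> nat) :
    Prop :=
  exists (D : sp_algorithm) (kappa c : nat),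
  forall (w N m s t : nat) (E : seq (nat * nat)) (qs : seq request),
    (m + 2) ^ kappa <= 2 ^ w ->
    is_instance directed md N m s t E qs ->
    exists (tp T : nat) (st : state),
      [/\ call w (sp_prep D) (graph_words N m s t E) state0 tp st,
          tp <= c * P m,
          serves w (sp_proc D) request_words (next_graph md)
            (request_ok directed N s t) E qs st T
        & T <= c * ((m + size qs) * u m)].

(** * OMv3 *)

Definition omv3_query (n : nat) : Type :=
  ('rV[bool]_n * 'rV[bool]_n * 'rV[bool]_n)%type.

Definition omv3_answer (n : nat) (A : 'M[bool]_n) (q : omv3_query n) : bool :=
  let: (u, v, x) := q in
  [exists i : 'I_n, exists j : 'I_n, exists k : 'I_n,
    [&& u ord0 i, v ord0 j, x ord0 k, A i j, A j k & A k i]].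

Definition vector_words (n : nat) (v : 'rV[bool]_n) : seq nat :=
  [seq nat_of_bool (v ord0 i) | i <- enum 'I_n].

(* The side length, then the entries row by row. *)
Definition matrix_words (n : nat) (A : 'M[bool]_n) : seq nat :=
  n :: [seq nat_of_bool (A i j) | i <- enum 'I_n, j <- enum 'I_n].

Definition omv3_words (n : nat) (q : omv3_query n) : seq nat :=
  let: (u, v, x) := q in vector_words u ++ vector_words v ++ vector_words x.

(* [prep] time O(pre n), and O(tot n) total time for the n online queries, on
   every word length w >= kappa * log2 (n + 2). *)
Definition solves_OMv3 (pre tot : nat -> nat) : Prop :=
  exists (prep query : cmd) (kappa c : nat),
  forall (w n : nat) (A : 'M[bool]_n) (qs : seq (omv3_query n)),
    0 < n ->
    (n + 2) ^ kappa <= 2 ^ w ->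
    size qs = n ->
    exists (tp T : nat) (st : state),
      [/\ call w prep (matrix_words A) state0 tp st,
          tp <= c * pre n,
          serves w (fun=> query) (@omv3_words n) (fun A' _ => A')
            (fun A' q r => r = omv3_answer A' q) A qs st T
        & T <= c * tot n].

(* Main.v *)
From mathcomp Require Import all_boot all_algebra zify.
Require Import Defs.
Set Implicit Arguments.
Unset Strict Implicit.
Unset Printing Implicit Defensive.

(** An OMv3 query asks for a closed walk i, j, k, i with u_i, v_j, w_k.  In a
    layered graph, s reaches row i, then a vertex j with A[i,j], then a vertex
    k with A[j,k], then a copy of row i with A[k,i], and then t.  The rows are
    attached to long paths at s and at t, and each vertex j and k is left
    through a path of its own; a shortest s-t path uses the attachments nearest
    to the beginning of these paths, so the current distance sees only the
    attachments of the current query and row, although links are only ever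
    inserted (moving towards the beginning) or only ever deleted (moving
    away).  A failed test costs one extra step, and a 1-Lipschitz potential
    shows that without a triangle the distance exceeds the value it has with
    one.  Every query thus takes O(n) updates and n distance queries on a
    single graph with O(n^2) edges, all of them independent of the answers,
    and the hypothesis is applied once to the whole request sequence.  Since
    the input length is charged, P(m) = Omega(n^2) and u(m) >= 1 absorb the
    overhead. *)

(** * Programming the word RAM *)

(** A single distance cannot tell whether a walk ends in the row where it began; hence the rows are
    tested one at a time, through a start link and an end link of the same row. These links change
    at each of the n^2 tests and need paths of length n^2, but one such path at s and one at t
    suffice. The masks change only n times, so each of the 2n chains has length n; this balance
    keeps the graph at O(n^2) edges. The vector u does not enter the graph: the program itself
    combines u_i with the outcome of the test of row i. False matrix entries get edges too, which
    lead one step less far, so the number of edges is a function of n alone and the bounds P and u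
    are evaluated at the single argument [num_edges n]. Finally, an amortized bound says nothing
    about one call; the loop invariants therefore contain the simulated time that is still to
    come. *)

(* Registers below [first_tmp] hold our variables, those from [first_tmp] to
   [reg_shift - 1] intermediate values, and register [x] (array [a]) of the
   simulated algorithm is stored in register [x + reg_shift] (array
   [a + arr_shift]). *)
Definition first_tmp := 20.
Definition reg_shift := 40.
Definition arr_shift := 10.

Definition persistent (y : nat) : bool := (y < first_tmp) || (reg_shift <= y).

Inductive expr :=
  | ENat of nat
  | EReg of nat
  | EAdd of expr & expr
  | ESub of expr & expr
  | EMul of expr & expr.

Fixpoint eval (st : state) (e : expr) : nat :=
  match e with
  | ENat k => k
  | EReg x => reg st x
  | EAdd e1 e2 => eval st e1 + eval st e2
  | ESub e1 e2 => eval st e1 - eval st e2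
  | EMul e1 e2 => eval st e1 * eval st e2
  end.

Fixpoint no_underflow (st : state) (e : expr) : Prop :=
  match e with
  | ENat _ | EReg _ => True
  | EAdd e1 e2 | EMul e1 e2 => no_underflow st e1 /\ no_underflow st e2
  | ESub e1 e2 =>
      [/\ no_underflow st e1, no_underflow st e2 & eval st e2 <= eval st e1]
  end.

Fixpoint depth (e : expr) : nat :=
  match e with
  | ENat _ | EReg _ => 1
  | EAdd e1 e2 | ESub e1 e2 | EMul e1 e2 => maxn (depth e1) (depth e2).+1
  end.

Fixpoint vars (e : expr) : seq nat :=
  match e with
  | ENat _ => [::]
  | EReg x => [:: x]
  | EAdd e1 e2 | ESub e1 e2 | EMul e1 e2 => vars e1 ++ vars e2
  end.

Definition vars_ok (e : expr) : bool := all persistent (vars e).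

(* The value of [e] ends up in register [d], and only the registers from [d]
   to [d + depth e - 1] are modified. *)
Fixpoint compile (d : nat) (e : expr) : cmd :=
  let bin o e1 e2 :=
    Seq (compile d e1) (Seq (compile d.+1 e2) (Op d o d d.+1)) in
  match e with
  | ENat k => Const d k
  | EReg x => Seq (Const d 0) (Op d Add x d)
  | EAdd e1 e2 => bin Add e1 e2
  | ESub e1 e2 => bin Sub e1 e2
  | EMul e1 e2 => bin Mul e1 e2
  end.

Fixpoint cost (e : expr) : nat :=
  match e with
  | ENat _ => 1
  | EReg _ => 2
  | EAdd e1 e2 | ESub e1 e2 | EMul e1 e2 => cost e1 + (cost e2 + 1)
  end.

Lemma reg_set_reg x v st y :
  reg (set_reg x v st) y = if y == x then v else reg st y.
Proof. by []. Qed.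

Lemma arr_set_reg x v st : arr (set_reg x v st) = arr st.
Proof. by []. Qed.

Lemma arr_set_arr a i v st b j :
  arr (set_arr a i v st) b j = if (b == a) && (j == i) then v else arr st b j.
Proof. by []. Qed.

Lemma eval_agree st st' e :
  {in vars e, forall y, reg st' y = reg st y} -> eval st' e = eval st e.
Proof.
elim: e => //= [x h|e1 h1 e2 h2 h|e1 h1 e2 h2 h|e1 h1 e2 h2 h].
  by apply: h; rewrite inE.
all: by rewrite h1 ?h2 // => y ye; apply: h; rewrite mem_cat ye ?orbT.
Qed.

Lemma no_underflow_agree st st' e :
  {in vars e, forall y, reg st' y = reg st y} ->
  no_underflow st e -> no_underflow st' e.
Proof.
elim: e => //= e1 h1 e2 h2 h.
all: have v1 : {in vars e1, forall y, reg st' y = reg st y}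
  by move=> y ye; apply: h; rewrite mem_cat ye.
all: have v2 : {in vars e2, forall y, reg st' y = reg st y}
  by move=> y ye; apply: h; rewrite mem_cat ye orbT.
- by case=> /(h1 v1) ? /(h2 v2).
- by case=> /(h1 v1) ? /(h2 v2) ?; rewrite !(eval_agree v1, eval_agree v2).
- by case=> /(h1 v1) ? /(h2 v2).
Qed.

Lemma eval_eq st st' e :
  (forall y, persistent y -> reg st' y = reg st y) -> vars_ok e ->
  eval st' e = eval st e.
Proof. by move=> h /allP ve; apply: eval_agree => y /ve/h. Qed.

Lemma no_underflow_eq st st' e :
  (forall y, persistent y -> reg st' y = reg st y) -> vars_ok e ->
  no_underflow st e -> no_underflow st' e.
Proof. by move=> h /allP ve; apply: no_underflow_agree => y /ve/h. Qed.

Lemma modn_subr p x y y' : 0 < p -> y <= x -> y' = y %% p ->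
  (x %% p + (p - y')) %% p = (x - y) %% p.
Proof.
move=> p0 yx ->; have ymp : y %% p < p by rewrite ltn_mod.
have yE := divn_eq y p.
suff -> : (x - y) %% p = (x - y + (y %/ p).+1 * p) %% p.
  rewrite modnDml; congr (_ %% p).
  by rewrite mulSn; lia.
by rewrite addnC modnMDl.
Qed.

(** Addition, multiplication and subtraction without underflow commute with reduction modulo
    [2 ^ w]. Intermediate values may thus overflow; only a final value has to fit into a word. *)
Lemma compile_runs w e d st :
  vars_ok e -> first_tmp <= d -> d + depth e <= reg_shift ->
  no_underflow st e ->
  exists st', [/\ runs w (compile d e) st (cost e) st', arr st' = arr st,
    forall y, (y < d) || (reg_shift <= y) -> reg st' y = reg st y
    & reg st' d = eval st e %% 2 ^ w].
Proof.
have p0 : 0 < 2 ^ w by rewrite expn_gt0.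
elim: e d st => [k|x|e1 IH1 e2 IH2|e1 IH1 e2 IH2|e1 IH1 e2 IH2] d st /=.
- move=> _ _ hd _; exists (set_reg d (wrap w k) st); split=> //.
  + exact: runs_const.
  + by move=> y hy; rewrite reg_set_reg; case: eqP => // yd; lia.
  + by rewrite reg_set_reg eqxx.
- rewrite /vars_ok /= andbT => px fd hd _.
  exists (set_reg d (eval_binop w Add (reg st x) 0)
    (set_reg d (wrap w 0) st)); split=> //.
  + apply: (@runs_seq _ _ _ _ 1 (set_reg d (wrap w 0) st) 1).
      exact: runs_const.
    have -> : eval_binop w Add (reg st x) 0 = eval_binop w Add
        (reg (set_reg d (wrap w 0) st) x) (reg (set_reg d (wrap w 0) st) d).
      rewrite !reg_set_reg eqxx ifN; first by rewrite /wrap mod0n.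
      by apply/eqP => xd; move: px fd hd; rewrite xd /persistent; lia.
    exact: runs_op.
  + by move=> y hy; rewrite !reg_set_reg; case: eqP => // yd; lia.
  + by rewrite reg_set_reg eqxx /eval_binop /wrap addn0.
all: rewrite /vars_ok /= all_cat => /andP[v1 v2] fd hd.
all: have hd1 : d + depth e1 <= reg_shift by lia.
all: have hd2 : d.+1 + depth e2 <= reg_shift by lia.
all: have fd2 : first_tmp <= d.+1 by lia.
1,3: case=> u1 u2; have u12 : True by [].
3: case=> u1 u2 u12.
all: have [st1 [r1 a1 k1 d1]] := IH1 d st v1 fd hd1 u1.
all: have k1' : forall y, persistent y -> reg st1 y = reg st y
  by move=> y; rewrite /persistent => py; apply: k1; lia.
all: have [st2 [r2 a2 k2 d2]] := IH2 d.+1 st1 v2 fd2 hd2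
  (no_underflow_eq k1' v2 u2).
all: eexists; split;
  first by apply: runs_seq r1 (runs_seq r2 (runs_op _ _ _ _ _ _)).
all: rewrite ?arr_set_reg ?a2 //.
all: try by move=> y hy; rewrite reg_set_reg; case: eqP => [yd|_]; [lia|];
  rewrite k2 ?k1 //; lia.
all: rewrite reg_set_reg eqxx d2 k2 ?ltnSn // d1 (eval_eq k1') //.
- by rewrite /eval_binop /wrap modnDm.
- by rewrite /eval_binop /wrap modnMm.
- by rewrite /eval_binop /wrap (@modn_subr _ _ (eval st e2)).
Qed.

(** * A program logic that keeps track of elapsed time *)

(** Total correctness: a halting run has to exist. The postcondition receives the time spent before
    the run plus its length, so time bounds are carried along like any other assertion. *)
Definition wp (w : nat) (c : cmd) (Q : nat -> state -> Prop) (tau : nat)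
    (st : state) : Prop :=
  exists t st', runs w c st t st' /\ Q (tau + t) st'.

Lemma wp_seq w c1 c2 Q tau st :
  wp w c1 (wp w c2 Q) tau st -> wp w (Seq c1 c2) Q tau st.
Proof.
case=> t1 [st1 [r1 [t2 [st2 [r2 q]]]]]; exists (t1 + t2), st2.
by rewrite addnA; split=> //; apply: runs_seq r1 r2.
Qed.

Lemma wp_mono w c (Q Q' : nat -> state -> Prop) tau st :
  (forall tau' st', Q tau' st' -> Q' tau' st') ->
  wp w c Q tau st -> wp w c Q' tau st.
Proof. by move=> h [t [st' [r q]]]; exists t, st'; split=> //; apply: h. Qed.

Lemma wp_skip w (Q : nat -> state -> Prop) tau st :
  Q tau.+1 st -> wp w Skip Q tau st.
Proof. by exists 1, st; rewrite addn1; split=> //; apply: runs_skip. Qed.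

Lemma wp_if w x c1 c2 (Q : nat -> state -> Prop) tau st :
  wp w (if reg st x != 0 then c1 else c2) Q tau.+1 st ->
  wp w (If x c1 c2) Q tau st.
Proof.
by move=> [t [st' [r q]]]; exists t.+1, st'; rewrite addnS -addSn; split=> //;
  apply: runs_if.
Qed.

Definition writes_reg (x v : nat) (st st' : state) : Prop :=
  arr st' = arr st /\ forall y, persistent y ->
    reg st' y = if y == x then v else reg st y.

(** The register beyond [depth e] is reserved because [store] compiles its second operand from
    [first_tmp.+1] upwards. *)
Definition fits (e : expr) : bool :=
  vars_ok e && (first_tmp + (depth e).+1 <= reg_shift).

(** The RAM has no move instruction, so the value is copied by adding a zero. *)
Definition assign (x : nat) (e : expr) : cmd :=
  Seq (compile first_tmp e) (Seq (Const first_tmp.+1 0)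
    (Op x Add first_tmp first_tmp.+1)).

Lemma wp_assign w x e (Q : nat -> state -> Prop) tau st :
  persistent x -> fits e -> no_underflow st e -> eval st e < 2 ^ w ->
  (forall st', writes_reg x (eval st e) st st' -> Q (tau + (cost e + 2)) st') ->
  wp w (assign x e) Q tau st.
Proof.
move=> px /andP[ve de] ue be h.
have de' : first_tmp + depth e <= reg_shift by lia.
have [st1 [r1 a1 k1 d1]] := compile_runs w ve (leqnn _) de' ue.
set st2 := set_reg first_tmp.+1 (wrap w 0) st1.
exists (cost e + 2); eexists; split.
  apply: runs_seq r1 _.
  apply: (@runs_seq _ _ _ _ 1 st2 1); first exact: runs_const.
  exact: runs_op.
apply: h; split=> [|y py] //.
rewrite reg_set_reg; case: eqP => [_|_].
  rewrite !reg_set_reg eqxx /= d1 /eval_binop /wrap mod0n addn0 modn_mod.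
  by rewrite modn_small.
rewrite reg_set_reg ifN ?k1 //.
by apply/eqP=> yE; move: py; rewrite yE.
Qed.

Definition load (x a : nat) (e : expr) : cmd :=
  Seq (compile first_tmp e) (Read x a first_tmp).

Lemma wp_load w x a e (Q : nat -> state -> Prop) tau st :
  persistent x -> fits e -> no_underflow st e -> eval st e < 2 ^ w ->
  (forall st', writes_reg x (arr st a (eval st e)) st st' ->
     Q (tau + (cost e + 1)) st') ->
  wp w (load x a e) Q tau st.
Proof.
move=> px /andP[ve de] ue be h.
have de' : first_tmp + depth e <= reg_shift by lia.
have [st1 [r1 a1 k1 d1]] := compile_runs w ve (leqnn _) de' ue.
exists (cost e + 1); eexists; split.
  by apply: runs_seq r1 _; apply: runs_read.
apply: h; split=> [|y py] //.
rewrite reg_set_reg; case: eqP => [_|_]; last by rewrite k1.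
by rewrite d1 modn_small // a1.
Qed.

Lemma compile2_runs w e1 e2 st :
  fits e1 -> fits e2 -> no_underflow st e1 -> no_underflow st e2 ->
  eval st e1 < 2 ^ w -> eval st e2 < 2 ^ w ->
  exists st', [/\ forall c t st'', runs w c st' t st'' ->
      runs w (Seq (compile first_tmp e1) (Seq (compile first_tmp.+1 e2) c)) st
        (cost e1 + (cost e2 + t)) st'',
    arr st' = arr st,
    forall y, persistent y -> reg st' y = reg st y,
    reg st' first_tmp = eval st e1
    & reg st' first_tmp.+1 = eval st e2].
Proof.
move=> /andP[v1 d1] /andP[v2 d2] u1 u2 b1 b2.
have d1' : first_tmp + depth e1 <= reg_shift by lia.
have d2' : first_tmp.+1 + depth e2 <= reg_shift by lia.
have [st1 [r1 a1 k1 e1E]] := compile_runs w v1 (leqnn _) d1' u1.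
have [st2 [r2 a2 k2 e2E]] :=
  compile_runs w v2 (leqnSn _) d2' (no_underflow_eq k1 v2 u2).
exists st2; split.
- by move=> c t st'' r; apply: runs_seq r1 (runs_seq r2 r).
- by rewrite a2.
- move=> y; rewrite /persistent => py.
  by rewrite k2 ?k1 //; lia.
- by rewrite k2 // e1E modn_small.
- by rewrite e2E (eval_eq k1) // modn_small.
Qed.

Definition store (a : nat) (e1 e2 : expr) : cmd :=
  Seq (compile first_tmp e1)
    (Seq (compile first_tmp.+1 e2) (Write a first_tmp first_tmp.+1)).

Definition writes_arr (a i v : nat) (st st' : state) : Prop :=
  (forall b j, arr st' b j = if (b == a) && (j == i) then v else arr st b j) /\
  forall y, persistent y -> reg st' y = reg st y.

Lemma wp_store w a e1 e2 (Q : nat -> state -> Prop) tau st :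
  fits e1 -> fits e2 -> no_underflow st e1 -> no_underflow st e2 ->
  eval st e1 < 2 ^ w -> eval st e2 < 2 ^ w ->
  (forall st', writes_arr a (eval st e1) (eval st e2) st st' ->
     Q (tau + (cost e1 + (cost e2 + 1))) st') ->
  wp w (store a e1 e2) Q tau st.
Proof.
move=> f1 f2 u1 u2 b1 b2 h.
have [st2 [r a2 k2 e1E e2E]] := compile2_runs f1 f2 u1 u2 b1 b2.
exists (cost e1 + (cost e2 + 1)); eexists; split.
  by apply: r; apply: runs_write.
by apply: h; split=> // b j; rewrite arr_set_arr a2 e1E e2E.
Qed.

Lemma word_gt1 w : 0 < w -> 1 < 2 ^ w.
Proof. by move=> w0; rewrite -{1}(expn0 2) ltn_exp2l. Qed.

Definition if_less (x : nat) (e : expr) (c1 c2 : cmd) : cmd :=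
  Seq (compile first_tmp e)
    (Seq (Op first_tmp Lt x first_tmp) (If first_tmp c1 c2)).

Definition same_persistent (st st' : state) : Prop :=
  arr st' = arr st /\ forall y, persistent y -> reg st' y = reg st y.

Lemma wp_if_less w x e c1 c2 (Q : nat -> state -> Prop) tau st :
  persistent x -> fits e -> no_underflow st e -> eval st e < 2 ^ w -> 0 < w ->
  (forall st', same_persistent st st' ->
     wp w (if reg st x < eval st e then c1 else c2) Q
       (tau + (cost e + 2)) st') ->
  wp w (if_less x e c1 c2) Q tau st.
Proof.
move=> px /andP[ve de] ue be w0 h.
have de' : first_tmp + depth e <= reg_shift by lia.
have [st2 [r a2 k2 eE]] := compile_runs w ve (leqnn _) de' ue.
set v := eval_binop w Lt (reg st2 x) (reg st2 first_tmp).
set st3 := set_reg first_tmp v st2.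
have vE : v = (reg st x < eval st e).
  rewrite /v k2 // eE (modn_small be) /eval_binop /wrap modn_small //.
  by case: (reg st x < _); rewrite ?expn_gt0 // word_gt1.
have [|t [st' [r' q]]] := h st3.
  split=> // y py; rewrite reg_set_reg ifN ?k2 //.
  by apply/eqP=> yE; move: py; rewrite yE.
exists (cost e + (1 + t.+1)), st'; split.
  apply: runs_seq r _; apply: runs_seq (runs_op _ _ _ _ _ _) _.
  have nz : (reg st3 first_tmp != 0) = (reg st x < eval st e).
    by rewrite reg_set_reg eqxx vE eqb0 negbK.
  by apply: runs_if; rewrite -/v -/st3 nz.
by congr (Q _ st'): q; lia.
Qed.

(* The number of iterations is the content of register 2, which holds the
   dimension [n] throughout. *)
Definition for_loop (x : nat) (body : cmd) : cmd :=
  Seq (Const x 0) (Seq (Op first_tmp Lt x 2)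
    (While first_tmp (Seq body (Seq (Const first_tmp 1)
      (Seq (Op x Add x first_tmp) (Op first_tmp Lt x 2)))))).

(** Induction on the number of remaining iterations. Control costs two steps before the loop, four
    per iteration and one for the exit. The condition is recomputed after the body, which may
    therefore destroy all temporaries. *)
Lemma wp_for w x body n (I : nat -> nat -> state -> Prop)
    (Q : nat -> state -> Prop) tau st :
  x < first_tmp -> x != 2 -> n < 2 ^ w -> 0 < w ->
  reg st 2 = n ->
  (forall st', writes_reg x 0 st st' -> I 0 (tau + 2) st') ->
  (forall k tau st, k < n -> I k tau st -> reg st x = k -> reg st 2 = n ->
     wp w body (fun tau' st' => [/\ reg st' x = k, reg st' 2 = n &
       forall st'', writes_reg x k.+1 st' st'' -> I k.+1 (tau' + 4) st''])
     tau st) ->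
  (forall tau st, I n tau st -> Q tau.+1 st) ->
  wp w (for_loop x body) Q tau st.
Proof.
move=> xF x2 nw w0 st2 h0 hS hQ.
have w1 := word_gt1 w0.
have xT : (x == first_tmp) = false by apply/negbTE; rewrite neq_ltn xF.
have Tx : (first_tmp == x) = false by rewrite eq_sym.
have pT y : persistent y -> (y == first_tmp) = false.
  by move=> py; apply/eqP => yE; move: py; rewrite yE.
have ltE a b : eval_binop w Lt a b = (a < b).
  by rewrite /eval_binop /wrap modn_small //; case: (a < b); lia.
have loop k : forall tau1 st1, k <= n -> reg st1 x = n - k -> reg st1 2 = n ->
    reg st1 first_tmp = (n - k < n) -> I (n - k) tau1 st1 ->
    wp w (While first_tmp (Seq body (Seq (Const first_tmp 1)
      (Seq (Op x Add x first_tmp) (Op first_tmp Lt x 2))))) Q tau1 st1.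
  elim: k => [|k IH] tau1 st1 kn x1 n1 T1 I1.
    exists 1, st1; rewrite addn1; split.
      by apply: runs_while_end; rewrite T1 subn0 ltnn.
    by apply: hQ; rewrite subn0 in I1.
  have kn' : n - k.+1 < n by lia.
  have [t [st2' [r2 [x2' n2 I2]]]] := hS _ _ _ kn' I1 x1 n1.
  set st3 := set_reg first_tmp (wrap w 1) st2'.
  set st4 := set_reg x (eval_binop w Add (reg st3 x) (reg st3 first_tmp)) st3.
  set st5 := set_reg first_tmp (eval_binop w Lt (reg st4 x) (reg st4 2)) st4.
  have x4 : reg st4 x = n - k.
    rewrite !reg_set_reg !eqxx xT x2' /eval_binop /wrap (modn_small w1).
    by rewrite modn_small; lia.
  have n4 : reg st4 2 = n by rewrite !reg_set_reg eq_sym (negbTE x2).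
  have wr : writes_reg x (n - k.+1).+1 st2' st5.
    split=> // y py; rewrite reg_set_reg pT //.
    case: (y =P x) => [->|/eqP yx]; first by rewrite x4; lia.
    by rewrite !reg_set_reg (negbTE yx) pT.
  have := I2 _ wr; have -> : (n - k.+1).+1 = n - k by lia.
  move=> I5.
  have [||||t' [st6 [r6 q6]]] := IH (tau1 + t + 4) st5 _ _ _ _ I5.
  - lia.
  - by rewrite reg_set_reg xT.
  - by rewrite reg_set_reg.
  - by rewrite reg_set_reg eqxx ltE x4 n4.
  exists ((t + (1 + (1 + 1))) + t').+1, st6; split.
    apply: (@runs_while_step _ _ _ _ _ st5) r6; first by rewrite T1 kn'.
    apply: runs_seq r2 (runs_seq (runs_const _ _ _ _) _).
    exact: runs_seq (runs_op _ _ _ _ _ _) (runs_op _ _ _ _ _ _).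
  by congr (Q _ st6): q6; lia.
set st1 := set_reg x (wrap w 0) st.
set st2' := set_reg first_tmp (eval_binop w Lt (reg st1 x) (reg st1 2)) st1.
have [|||||t [st3 [r q]]] := loop n (tau + 2) st2'.
- by [].
- by rewrite !reg_set_reg xT eqxx /wrap mod0n subnn.
- by rewrite !reg_set_reg /= eq_sym (negbTE x2).
- rewrite reg_set_reg eqxx ltE !reg_set_reg eqxx eq_sym (negbTE x2) st2.
  by rewrite /wrap mod0n subnn.
- rewrite subnn; apply: h0; split=> // y py.
  by rewrite !reg_set_reg pT // /wrap mod0n.
exists (1 + (1 + t)), st3; split.
  apply: runs_seq (runs_const _ _ _ _) (runs_seq (runs_op _ _ _ _ _ _) r).
by congr (Q _ st3): q; lia.
Qed.

(** * Running a program inside another one *)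

Fixpoint shift_cmd (c : cmd) : cmd :=
  let r x := x + reg_shift in
  let s a := a + arr_shift in
  match c with
  | Skip => Skip
  | Const x k => Const (r x) k
  | Op x o y z => Op (r x) o (r y) (r z)
  | Read x a y => Read (r x) (s a) (r y)
  | Write a x y => Write (s a) (r x) (r y)
  | Seq c1 c2 => Seq (shift_cmd c1) (shift_cmd c2)
  | If x c1 c2 => If (r x) (shift_cmd c1) (shift_cmd c2)
  | While x c => While (r x) (shift_cmd c)
  end.

Definition embeds (sg st : state) : Prop :=
  (forall x, reg st (x + reg_shift) = reg sg x) /\
  forall a i, arr st (a + arr_shift) i = arr sg a i.

Definition same_own (st st' : state) : Prop :=
  (forall y, y < first_tmp -> reg st' y = reg st y) /\
  forall a i, a < arr_shift -> arr st' a i = arr st a i.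

Lemma same_own_trans st1 st2 st3 :
  same_own st1 st2 -> same_own st2 st3 -> same_own st1 st3.
Proof.
move=> [r1 a1] [r2 a2]; split=> *; first by rewrite r2 ?r1.
by rewrite a2 ?a1.
Qed.

Lemma shift_runs w c sg t sg' st :
  runs w c sg t sg' -> embeds sg st ->
  exists st', [/\ runs w (shift_cmd c) st t st', embeds sg' st'
    & same_own st st'].
Proof.
have setR x v sg1 st1 : embeds sg1 st1 ->
    embeds (set_reg x v sg1) (set_reg (x + reg_shift) v st1) /\
    same_own st1 (set_reg (x + reg_shift) v st1).
  move=> [er ea]; split; split=> //= y; first by rewrite eqn_add2r er.
  rewrite /first_tmp => yF; rewrite ifN // /reg_shift; lia.
move=> r; elim: r st => {c sg t sg'}.
- by move=> sg st em; exists st; split=> //; apply: runs_skip.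
- move=> x k sg st em; have [e1 o1] := setR x (wrap w k) _ _ em.
  by eexists; split; [apply: runs_const|exact: e1|exact: o1].
- move=> x o y z sg st em.
  have [e1 o1] := setR x (eval_binop w o (reg sg y) (reg sg z)) _ _ em.
  eexists; split; last exact: o1; last exact: e1.
  by case: (em) => er _; rewrite -!er; apply: runs_op.
- move=> x a y sg st em.
  have [e1 o1] := setR x (arr sg a (reg sg y)) _ _ em.
  eexists; split; last exact: o1; last exact: e1.
  by case: (em) => er ea; rewrite -er -ea; apply: runs_read.
- move=> a x y sg st [er ea].
  eexists; split; first exact: runs_write.
    split=> //= b i; rewrite eqn_add2r !er; case: ifP => // _; exact: ea.
  split=> //= b i bA; by rewrite ifN // negb_and neq_ltn ltn_addl.
- move=> c1 c2 sg t1 sg1 t2 sg2 _ IH1 _ IH2 st em.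
  have [st1 [r1 e1 o1]] := IH1 _ em; have [st2 [r2 e2 o2]] := IH2 _ e1.
  exists st2; split=> //; first exact: runs_seq r1 r2.
  exact: same_own_trans o1 o2.
- move=> x c1 c2 sg t sg' _ IH st em; have [st1 [r1 e1 o1]] := IH _ em.
  exists st1; split=> //=; apply: runs_if.
  by case: em => er _; rewrite er; case: ifP r1.
- move=> x c sg x0 st em; exists st; split=> //.
  by apply: runs_while_end; case: em => ->.
- move=> x c sg t1 sg1 t2 sg2 x0 _ IH1 _ IH2 st em.
  have [st1 [r1 e1 o1]] := IH1 _ em; have [st2 [r2 e2 o2]] := IH2 _ e1.
  exists st2; split=> //; last exact: same_own_trans o1 o2.
  by apply: runs_while_step r1 r2; case: em => ->.
Qed.

(** * The graph *)

(* Vertices are laid out in blocks starting at the numbers [off a b n], in the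
   order in which a path from s to t visits them:
   - [x] for [x <= n * n] is the path starting at s = 0;
   - [off 1 1 n + i] is row [i] of the matrix, at the start of a triangle;
   - [off 1 2 n + (y * n + j)] for [y <= n] is a path on which the second
     vertex [j] of a triangle is left at a time-dependent position,
     [off 2 3 n + j] and [off 2 4 n + j] are its bad and good exits;
   - [off 2 5 n + _], [off 3 6 n + _] and [off 3 7 n + _] are the same for the
     third vertex;
   - [off 3 8 n + i] and [off 3 9 n + i] are the bad and good arrival at [i];
   - [off 4 10 n - x] for [x <= n * n] is the path ending at t = [off 4 10 n].
   A bad vertex is joined to the good one by an edge, so that a failed test
   costs exactly one additional step. *)
Definition off (a b n : nat) : nat := a * (n * n) + b * n.

Definition num_vertices (n : nat) : nat := (off 4 10 n).+1.
Definition num_edges (n : nat) : nat := off 13 3 n.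

(** The summand [A x j * n] selects level 1 of a chain for a true entry and level 0 for a false one;
    in the last edge it selects the good or the bad arrival. Every entry contributes one edge per
    layer, whatever its value. *)
Definition cell_edges (A : nat -> nat -> bool) (n x j : nat) :
    seq (nat * nat) :=
  [:: (x * n + j, (x * n + j).+1);
      (off 3 10 n + (x * n + j), (off 3 10 n + (x * n + j)).+1);
      (off 1 2 n + (x * n + j), off 1 3 n + (x * n + j));
      (off 2 5 n + (x * n + j), off 2 6 n + (x * n + j));
      (off 1 1 n + x, off 1 2 n + (A x j * n + j));
      (off 2 4 n + x, off 2 5 n + (A x j * n + j));
      (off 3 7 n + x, off 3 8 n + (A x j * n + j))].

Definition column_edges (n j : nat) : seq (nat * nat) :=
  [:: (off 2 3 n + j, off 2 4 n + j);
      (off 3 6 n + j, off 3 7 n + j);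
      (off 3 8 n + j, off 3 9 n + j)].

(** [off 1 3 n + (x * n + j)] is level [x.+1] of chain [j]: the exit of time [x] lies [x] steps
    behind the good entrance at level 1. *)
Definition mask1 (n x j : nat) (b : bool) : nat * nat :=
  (off 1 3 n + (x * n + j), off 2 3 n + (b * n + j)).

Definition mask2 (n x j : nat) (b : bool) : nat * nat :=
  (off 2 6 n + (x * n + j), off 3 6 n + (b * n + j)).

Definition start_link (n x j : nat) : nat * nat := (x * n + j, off 1 1 n + j).

Definition end_link (n x j : nat) : nat * nat :=
  (off 3 9 n + j, off 4 10 n - (x * n + j)).

Definition cell_links (n x j : nat) : seq (nat * nat) :=
  [:: mask1 n x j false; mask1 n x j true; mask2 n x j false;
      mask2 n x j true; start_link n x j; end_link n x j].

Definition grid (T : Type) (F : nat -> nat -> seq T) (n : nat) : seq T :=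
  flatten [seq flatten [seq F x j | j <- iota 0 n] | x <- iota 0 n].

Definition fixed_edges (A : nat -> nat -> bool) (n : nat) : seq (nat * nat) :=
  grid (cell_edges A n) n ++ flatten [seq column_edges n j | j <- iota 0 n].

Definition links (n : nat) : seq (nat * nat) := grid (cell_links n) n.

Lemma mem_iota0 n x : (x \in iota 0 n) = (x < n).
Proof. by rewrite mem_iota. Qed.

Lemma flatten_iotaP (T : eqType) (F : nat -> seq T) n e :
  reflect (exists2 x, x < n & e \in F x) (e \in flatten [seq F x | x <- iota 0 n]).
Proof.
apply: (iffP flatten_mapP) => [[x]|[x]]; rewrite ?mem_iota0 => xn ex; exists x => //.
by rewrite mem_iota0.
Qed.

Lemma gridP (T : eqType) (F : nat -> nat -> seq T) n e :
  reflect (exists x j, [/\ x < n, j < n & e \in F x j]) (e \in grid F n).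
Proof.
apply: (iffP (flatten_iotaP _ _ _)) => [[x xn]|[x [j [xn jn ej]]]].
  by case/flatten_iotaP=> j jn ej; exists x, j.
by exists x => //; apply/flatten_iotaP; exists j.
Qed.

Lemma cell_lt n x j : x < n -> j < n -> x * n + j < n * n.
Proof. nia. Qed.

Lemma size_flatten_iota (T : Type) (F : nat -> seq T) c a n :
  (forall x, size (F x) = c) ->
  size (flatten [seq F x | x <- iota a n]) = n * c.
Proof.
move=> h; rewrite size_flatten /shape -map_comp.
rewrite (@eq_map _ _ _ (fun=> c)) => [|x /=]; last exact: h.
by rewrite -[in RHS](size_iota a n); elim: (iota a n) => //= _ s ->.
Qed.

Lemma size_grid (T : Type) (F : nat -> nat -> seq T) c n :
  (forall x j, size (F x j) = c) -> size (grid F n) = n * (n * c).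
Proof.
by move=> h; apply: size_flatten_iota => x; apply: size_flatten_iota.
Qed.

Lemma size_fixed_edges A n : size (fixed_edges A n) = off 7 3 n.
Proof.
rewrite size_cat (@size_grid _ _ 7) // (@size_flatten_iota _ _ 3) //.
by rewrite /off; lia.
Qed.

Lemma size_links n : size (links n) = off 6 0 n.
Proof. by rewrite (@size_grid _ _ 6) // /off; lia. Qed.

Lemma fixed_edgesP A n e :
  reflect ((exists x j, [/\ x < n, j < n & e \in cell_edges A n x j]) \/
           exists2 j, j < n & e \in column_edges n j)
    (e \in fixed_edges A n).
Proof.
rewrite mem_cat; apply: (iffP orP) => -[h|h]; [left|right|left|right].
- exact/gridP.
- exact/flatten_iotaP.
- exact/gridP.
- exact/flatten_iotaP.
Qed.

Ltac split_mem :=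
  rewrite !inE; repeat (let H := fresh in move=> /orP[H|]; [move: H|]).

(** Edges point forward in the layout of the blocks. This rules out loops and puts the smaller
    endpoint first, so one and the same list is a legal directed and a legal undirected graph. *)
Lemma edge_bounds A n e :
  e \in fixed_edges A n ++ links n ->
  (e.1 < e.2) && (e.2 < num_vertices n).
Proof.
rewrite mem_cat /num_vertices; case/orP.
  case/fixed_edgesP => [[x [j [xn jn]]]|[j jn]].
    have k := cell_lt xn jn.
    by split_mem => /eqP-> /=; rewrite /off; case: (A x j); lia.
  by split_mem => /eqP-> /=; rewrite /off; nia.
case/gridP=> x [j [xn jn]]; have k := cell_lt xn jn.
by split_mem => /eqP-> /=; rewrite /off; nia.
Qed.

(** * No edge is listed twice *)

Lemma uniq_flatten_map (S T : eqType) (F : S -> seq T) s :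
  uniq s -> {in s, forall x, uniq (F x)} ->
  {in s &, forall x y e, e \in F x -> e \in F y -> x = y} ->
  uniq (flatten [seq F x | x <- s]).
Proof.
elim: s => //= x s IH /andP[xs us] uF dF; rewrite cat_uniq uF ?mem_head //=.
rewrite IH ?andbT //.
- apply/hasPn => e /flatten_mapP[y ys ey]; apply/negP => ex.
  by move: xs; rewrite (dF x y _ _ e ex ey) ?ys ?mem_head // inE ys orbT.
- by move=> y ys; apply: uF; rewrite inE ys orbT.
- by move=> y z ys zs; apply: dF; rewrite inE ?ys ?zs orbT.
Qed.

Lemma cell_inj n x j x' j' : j < n -> j' < n ->
  x * n + j = x' * n + j' -> x = x' /\ j = j'.
Proof.
move=> jn jn' eq; have n0 : 0 < n by lia.
have := congr1 (divn^~ n) eq; have := congr1 (modn^~ n) eq.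
by rewrite !modnMDl !divnMDl // !modn_small // !divn_small // !addn0.
Qed.

Lemma uniq_grid (T : eqType) (F : nat -> nat -> seq T) n :
  (forall x j, x < n -> j < n -> uniq (F x j)) ->
  (forall x j x' j' e, x < n -> j < n -> x' < n -> j' < n ->
     e \in F x j -> e \in F x' j' -> x * n + j = x' * n + j') ->
  uniq (grid F n).
Proof.
move=> uF dF; apply: uniq_flatten_map; rewrite ?iota_uniq //.
  move=> x; rewrite mem_iota0 => xn; apply: uniq_flatten_map.
  - exact: iota_uniq.
  - by move=> j; rewrite mem_iota0; apply: uF.
  move=> j j'; rewrite !mem_iota0 => jn jn' e ej ej'.
  by have [] := cell_inj jn jn' (dF _ _ _ _ _ xn jn xn jn' ej ej').
move=> x x'; rewrite !mem_iota0 => xn xn' e.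
case/flatten_iotaP=> j jn ej /flatten_iotaP[j' jn' ej'].
by have [] := cell_inj jn jn' (dF _ _ _ _ _ xn jn xn' jn' ej ej').
Qed.

(** The sixteen tags are the seven kinds of cell edges, the three kinds of column edges and the six
    kinds of links, recognized by the blocks that contain the endpoints. *)
Definition edge_tag (n : nat) (e : nat * nat) : nat :=
  if e.1 < off 1 1 n then (if e.2 < off 1 1 n then 0 else 1)
  else if e.1 < off 1 2 n then 2
  else if e.1 < off 2 3 n then
    (if e.2 < off 2 3 n then 3 else if e.2 < off 2 4 n then 4 else 5)
  else if e.1 < off 2 4 n then 6
  else if e.1 < off 2 5 n then 7
  else if e.1 < off 3 6 n then
    (if e.2 < off 3 6 n then 8 else if e.2 < off 3 7 n then 9 else 10)
  else if e.1 < off 3 7 n then 11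
  else if e.1 < off 3 8 n then 12
  else if e.1 < off 3 9 n then 13
  else if e.1 < off 3 10 n then 14
  else 15.

(** Recovers the number of the cell, or the column, that an edge comes from. Reduction modulo [n]
    removes the summand [A x j * n], so the matrix does not occur here. *)
Definition edge_index (n : nat) (e : nat * nat) : nat :=
  match edge_tag n e with
  | 0 | 1 => e.1
  | 2 => (e.1 - off 1 1 n) * n + (e.2 - off 1 2 n) %% n
  | 3 => e.1 - off 1 2 n
  | 4 | 5 => e.1 - off 1 3 n
  | 6 => e.1 - off 2 3 n
  | 7 => (e.1 - off 2 4 n) * n + (e.2 - off 2 5 n) %% n
  | 8 => e.1 - off 2 5 n
  | 9 | 10 => e.1 - off 2 6 n
  | 11 => e.1 - off 3 6 n
  | 12 => (e.1 - off 3 7 n) * n + (e.2 - off 3 8 n) %% n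
  | 13 => e.1 - off 3 8 n
  | 14 => off 4 10 n - e.2
  | _ => e.1 - off 3 10 n
  end.

Ltac tag := unfold edge_tag; cbn [fst snd];
  repeat (case: ifP => ?; try (unfold off in *; lia)).

Lemma cell_edges_tag A n x j : x < n -> j < n ->
  [seq edge_tag n e | e <- cell_edges A n x j] = [:: 0; 15; 3; 8; 2; 7; 12].
Proof.
move=> xn jn; have k := cell_lt xn jn; rewrite /cell_edges /=.
by case: (A x j); repeat (congr cons); tag.
Qed.

Lemma cell_links_tag n x j : x < n -> j < n ->
  [seq edge_tag n e | e <- cell_links n x j] = [:: 4; 5; 9; 10; 1; 14].
Proof.
move=> xn jn; have k := cell_lt xn jn.
rewrite /cell_links /mask1 /mask2 /start_link /end_link /=.
by repeat (congr cons); tag.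
Qed.

Lemma column_edges_tag n j : j < n ->
  [seq edge_tag n e | e <- column_edges n j] = [:: 6; 11; 13].
Proof. by move=> jn; rewrite /column_edges /=; repeat (congr cons); tag. Qed.

Lemma cell_edges_index A n x j : x < n -> j < n ->
  {in cell_edges A n x j, forall e, edge_index n e = x * n + j}.
Proof.
move=> xn jn e; have k := cell_lt xn jn.
have [t0 t1 t2 t3 t4 t5 t6] := cell_edges_tag A xn jn.
have dE : (A x j * n + j) %% n = j by rewrite modnMDl modn_small.
by split_mem => /eqP->; rewrite /edge_index ?t0 ?t1 ?t2 ?t3 ?t4 ?t5 ?t6;
  cbn [fst snd]; rewrite ?addKn ?dE.
Qed.

Lemma column_edges_index n j : j < n ->
  {in column_edges n j, forall e, edge_index n e = j}.
Proof.
move=> jn e; have [t0 t1 t2] := column_edges_tag jn.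
by split_mem => /eqP->; rewrite /edge_index ?t0 ?t1 ?t2;
  cbn [fst snd]; rewrite ?addKn.
Qed.

Lemma cell_links_index n x j : x < n -> j < n ->
  {in cell_links n x j, forall e, edge_index n e = x * n + j}.
Proof.
move=> xn jn e; have k := cell_lt xn jn.
have [t0 t1 t2 t3 t4 t5] := cell_links_tag xn jn.
split_mem => /eqP->; rewrite /edge_index ?t0 ?t1 ?t2 ?t3 ?t4 ?t5;
  cbn [fst snd]; rewrite ?addKn //.
by rewrite subKn // /off; lia.
Qed.

(** Within a cell or a column the tags differ; between cells or columns the indices differ; the
    three families of edges have disjoint sets of tags. *)
Lemma uniq_edges A n : uniq (fixed_edges A n ++ links n).
Proof.
have in_tags (s : seq (nat * nat)) e ts :
    [seq edge_tag n e' | e' <- s] = ts -> e \in s -> edge_tag n e \in ts.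
  by move=> <-; apply: map_f.
rewrite !cat_uniq -!andbA; apply/and5P; split.
- apply: uniq_grid => [x j xn jn|x j x' j' e xn jn xn' jn' he he'].
    by apply: (@map_uniq _ _ (edge_tag n)); rewrite cell_edges_tag.
  by rewrite -(cell_edges_index xn jn he) (cell_edges_index xn' jn' he').
- apply/hasPn => e /flatten_iotaP[j jn he]; apply/negP.
  case/gridP=> x' [j' [xn' jn']] /(in_tags _ _ _ (cell_edges_tag A xn' jn')).
  have := in_tags _ _ _ (column_edges_tag jn) he.
  by split_mem => /eqP->.
- apply: uniq_flatten_map => [|j|j j'].
  + exact: iota_uniq.
  + rewrite mem_iota0 => jn.
    by apply: (@map_uniq _ _ (edge_tag n)); rewrite column_edges_tag.
  rewrite !mem_iota0 => jn jn' e he he'.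
  by rewrite -(column_edges_index jn he) (column_edges_index jn' he').
- apply/hasPn => e /gridP[x' [j' [xn' jn' he']]].
  have := in_tags _ _ _ (cell_links_tag xn' jn') he' => te.
  apply/negP => /fixed_edgesP[[x [j [xn jn]]]|[j jn]].
    move=> /(in_tags _ _ _ (cell_edges_tag A xn jn)); move: te.
    by split_mem => /eqP->.
  move=> /(in_tags _ _ _ (column_edges_tag jn)); move: te.
  by split_mem => /eqP->.
- apply: uniq_grid => [x j xn jn|x j x' j' e xn jn xn' jn' he he'].
    by apply: (@map_uniq _ _ (edge_tag n)); rewrite cell_links_tag.
  by rewrite -(cell_links_index xn jn he) (cell_links_index xn' jn' he').
Qed.

(** * Distances *)

Lemma walk_cat directed E x y z k l :
  walk directed E x y k -> walk directed E y z l ->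
  walk directed E x z (k + l).
Proof.
case=> p [p1 p2 p3] [q [q1 q2 q3]]; exists (p ++ q).
by rewrite cat_path last_cat size_cat p1 p2 q1 q2 p3 q3.
Qed.

Lemma walk_edge directed E x y z l :
  (x, y) \in E -> walk directed E y z l -> walk directed E x z l.+1.
Proof.
move=> xy [p [p1 p2 p3]]; exists (y :: p).
by rewrite /= p1 p2 p3 /adj xy.
Qed.

Lemma walk0 directed E x : walk directed E x x 0.
Proof. by exists [::]. Qed.

Lemma walk_path directed E (f : nat -> nat) l :
  (forall k, k < l -> (f k, f k.+1) \in E) ->
  walk directed E (f 0) (f l) l.
Proof.
elim: l => [|l IH] h; first exact: walk0.
rewrite -addn1; apply: walk_cat (IH _) _ => [k kl|]; first exact/h/ltnW.
rewrite addn1; apply: walk_edge (h _ (ltnSn l)) (walk0 _ _ _).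
Qed.

(** The Lipschitz condition is stated in both directions because an undirected walk may traverse an
    edge backwards. *)
Lemma walk_potential directed E (phi : nat -> nat) x y l :
  (forall e, e \in E -> (phi e.1 <= (phi e.2).+1) && (phi e.2 <= (phi e.1).+1)) ->
  walk directed E x y l -> phi y <= phi x + l.
Proof.
move=> h [p [px <- <-]] {y l}; elim: p x px => [|y p IH] x /=.
  by rewrite addn0.
case/andP=> xy /IH; suff : phi y <= (phi x).+1 by lia.
by case/orP: xy => [/h/andP[]|/andP[_ /h/andP[]]].
Qed.

(* The links that exist while row [i] is tested with masks [v] and [z]: those
   of the current time [h] match the masks, all later ones exist, and no
   earlier one does. *)
Variant current_link (n h i : nat) (v z : nat -> bool) : nat * nat -> Prop :=
  | Current_mask1 x j b : x < n -> j < n ->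
      (h < x) || (x == h) && (b == v j) ->
      current_link n h i v z (mask1 n x j b)
  | Current_mask2 x j b : x < n -> j < n ->
      (h < x) || (x == h) && (b == z j) ->
      current_link n h i v z (mask2 n x j b)
  | Current_start x j : x < n -> j < n -> h * n + i <= x * n + j ->
      current_link n h i v z (start_link n x j)
  | Current_end x j : x < n -> j < n -> h * n + i <= x * n + j ->
      current_link n h i v z (end_link n x j).

Definition triangle_at (A : nat -> nat -> bool) (n : nat) (v z : nat -> bool)
    (i : nat) : bool :=
  has (fun k => has (fun j => [&& A i j, v j & A j k]) (iota 0 n)
        && z k && A k i) (iota 0 n).

Definition bound (n h i : nat) : nat := 2 * (h * n + i) + 2 * h + 8.

(** The walk takes [h * n + i] steps on each of the two outer paths, [h] steps on each of the two
    chains and seven single edges: start link, entry, exit, entry, exit, arrival, end link. The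
    constant 8 in [bound] is one more than seven. *)
Lemma triangle_walk directed A n h i v z E :
  h < n -> i < n -> {subset fixed_edges A n <= E} ->
  (forall e, current_link n h i v z e -> e \in E) ->
  triangle_at A n v z i -> walk directed E 0 (off 4 10 n) (bound n h i).-1.
Proof.
move=> hn iN fE cE /hasP[k]; rewrite mem_iota0 => kn /andP[/andP[]].
case/hasP=> j; rewrite mem_iota0 => jn /and3P[Aij vj Ajk] zk Aki.
have cE' x y : x < n -> y < n -> {subset cell_edges A n x y <= E}.
  by move=> xn yn e he; apply/fE/fixed_edgesP; left; exists x, y.
have n0 : 0 < n by lia.
have divlt m : m < n * n -> m %/ n < n by move=> mn; rewrite ltn_divLR.
have modlt m : m %% n < n by rewrite ltn_mod.
(* Entry 0 of the cell with number [m] is step [m] of the path at s, and entry 1 is step [m] of the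
   path at t. *)
have pathE c m : c < 2 -> m < n * n ->
    nth (0, 0) (cell_edges A n (m %/ n) (m %% n)) c \in E.
  move=> c2 mn; apply: (cE' (m %/ n) (m %% n)) => //; first exact: divlt.
  by apply: mem_nth => /=; lia.
have a_lt := cell_lt hn iN.
have -> : (bound n h i).-1 = (h * n + i) + (h + (h + (h * n + i).+3).+2).+2.
  by rewrite /bound; lia.
apply: (walk_cat (y := h * n + i)).
  apply: (@walk_path _ _ (id)) => m ma.
  by have := @pathE 0 m isT; rewrite /= -divn_eq; apply; lia.
apply: (walk_edge (y := off 1 1 n + i)).
  by apply: cE; apply: Current_start.
apply: (walk_edge (y := off 1 3 n + (0 * n + j))).
  apply: (cE' i j) => //; rewrite !inE Aij; apply/or4P; apply: Or44.
  by apply/or4P; apply: Or42; apply/eqP; congr pair; rewrite /off; lia.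
apply: (walk_cat (y := off 1 3 n + (h * n + j))).
  apply: (@walk_path _ _ (fun y => off 1 3 n + (y * n + j))) => y yh.
  apply: (cE' y.+1 j) => //; first lia.
  rewrite !inE; apply/or4P; apply: Or43.
  by apply/eqP; congr pair; rewrite /off; lia.
apply: (walk_edge (y := off 2 4 n + j)).
  have -> : (off 1 3 n + (h * n + j), off 2 4 n + j) = mask1 n h j true.
    by rewrite /mask1 /off; congr pair; lia.
  by apply: cE; apply: Current_mask1; rewrite // eqxx vj orbT.
apply: (walk_edge (y := off 2 6 n + (0 * n + k))).
  apply: (cE' j k) => //; rewrite !inE Ajk; apply/or4P; apply: Or44.
  by apply/or4P; apply: Or43; apply/eqP; congr pair; rewrite /off; lia.
apply: (walk_cat (y := off 2 6 n + (h * n + k))).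
  apply: (@walk_path _ _ (fun y => off 2 6 n + (y * n + k))) => y yh.
  apply: (cE' y.+1 k) => //; first lia.
  rewrite !inE; apply/or4P; apply: Or44; apply/or4P; apply: Or41.
  by apply/eqP; congr pair; rewrite /off; lia.
apply: (walk_edge (y := off 3 7 n + k)).
  have -> : (off 2 6 n + (h * n + k), off 3 7 n + k) = mask2 n h k true.
    by rewrite /mask2 /off; congr pair; lia.
  by apply: cE; apply: Current_mask2; rewrite // eqxx zk orbT.
apply: (walk_edge (y := off 3 9 n + i)).
  apply: (cE' k i) => //; rewrite !inE Aki; apply/or4P; apply: Or44.
  by apply/or4P; apply: Or44; apply/eqP; congr pair; rewrite /off; lia.
apply: (walk_edge (y := off 4 10 n - (h * n + i))).
  by apply: cE; apply: Current_end.
have := @walk_path directed E (fun y => off 4 10 n - (h * n + i) + y) (h * n + i).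
rewrite addn0 subnK; last by rewrite /off; lia.
apply=> y yh.
have := @pathE 1 (n * n - (h * n + i) + y) isT.
rewrite /= -divn_eq; have -> : off 3 10 n + (n * n - (h * n + i) + y) =
   off 4 10 n - (h * n + i) + y by rewrite /off; lia.
by rewrite addnS; apply; lia.
Qed.

(** * The potential that bounds distances from below *)

(** A good chain is entered at level 1 and a bad one at level 0, so level [y'.+1] is reached after
    [y'] or [y'.+1] steps. The cap is the value of a bad chain at the exit of time [h]. Level 0 has
    value 0 in both cases, which suffices for the Lipschitz condition. *)
Definition chain_pot (h y : nat) (good : bool) : nat :=
  if y is y'.+1 then minn (y' + ~~ good) h.+1 else 0.

Lemma chain_pot_step h y good :
  chain_pot h y good <= chain_pot h y.+1 good <= (chain_pot h y good).+1.
Proof. by case: y => [|y] /=; case: good => /=; lia. Qed.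

Lemma chain_pot_small h y good : y <= 1 -> chain_pot h y good <= ~~ good.
Proof. by case: y => [|[|]] //= _; case: good => /=; lia. Qed.

(** Among the available exits only that of a good chain at time [h] itself has value [h]; all others
    have [h.+1], which is why the unfiltered links of later times do no harm. *)
Lemma chain_pot_exit h x good : h <= x ->
  h + ((h < x) || ~~ good) <= chain_pot h x.+1 good <= h.+1.
Proof. by move=> hx /=; case: good; case: ltnP => /=; lia. Qed.

Section Potential.
Variables (A : nat -> nat -> bool) (n h i : nat) (v z : nat -> bool).
Hypotheses (hn : h < n) (iN : i < n).

Let a := h * n + i.
Let good_exit j := A i j && v j.
Let good_entry k := has (fun j => good_exit j && A j k) (iota 0 n).
Let good_exit2 k := good_entry k && z k.
Let good_end l := has (fun k => good_exit2 k && A k l) (iota 0 n).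

(* A good vertex has its distance from s as value, a bad one one more; the
   truncations keep the function 1-Lipschitz along the links of later times. *)
Definition potential (y : nat) : nat :=
  if y < off 1 1 n then minn y a.+1
  else if y < off 1 2 n then a.+1 + (y != off 1 1 n + i)
  else if y < off 2 3 n then
    let y' := y - off 1 2 n in a.+2 + chain_pot h (y' %/ n) (A i (y' %% n))
  else if y < off 2 4 n then a.+3 + h
  else if y < off 2 5 n then a.+3 + h + ~~ good_exit (y - off 2 4 n)
  else if y < off 3 6 n then
    let y' := y - off 2 5 n in
    a.+4 + h + chain_pot h (y' %/ n) (good_entry (y' %% n))
  else if y < off 3 7 n then a.+4.+1 + 2 * h
  else if y < off 3 8 n then a.+4.+1 + 2 * h + ~~ good_exit2 (y - off 3 7 n)
  else if y < off 3 9 n then a.+4.+2 + 2 * h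
  else if y < off 3 10 n then a.+4.+2 + 2 * h + ~~ good_end (y - off 3 9 n)
  else a.+4.+3 + 2 * h + (a.+1 - (off 4 10 n - y)).

Ltac block := rewrite /potential; repeat (case: ifP => ?; try (unfold off in *; lia)).

Let divE y j : j < n -> ((y * n + j) %/ n = y) * ((y * n + j) %% n = j).
Proof.
by move=> jn; rewrite divnMDl ?modnMDl ?divn_small ?modn_small ?addn0 //; lia.
Qed.

Lemma pot_start x : x <= n * n -> potential x = minn x a.+1.
Proof. by move=> xn; block. Qed.

Lemma pot_row j : j < n -> potential (off 1 1 n + j) = a.+1 + (j != i).
Proof. by move=> jn; block; rewrite eqn_add2l. Qed.

Lemma pot_chain1 y j : y <= n -> j < n ->
  potential (off 1 2 n + (y * n + j)) = a.+2 + chain_pot h y (A i j).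
Proof.
move=> yn jn; have : y * n <= n * n by rewrite leq_mul2r yn orbT.
by move=> ?; block; rewrite addKn !divE.
Qed.

Lemma pot_bad1 j : j < n -> potential (off 2 3 n + j) = a.+3 + h.
Proof. by move=> jn; block. Qed.

Lemma pot_good1 j : j < n ->
  potential (off 2 4 n + j) = a.+3 + h + ~~ good_exit j.
Proof. by move=> jn; block; rewrite addKn. Qed.

Lemma pot_chain2 y j : y <= n -> j < n ->
  potential (off 2 5 n + (y * n + j)) =
  a.+4 + h + chain_pot h y (good_entry j).
Proof.
move=> yn jn; have : y * n <= n * n by rewrite leq_mul2r yn orbT.
by move=> ?; block; rewrite addKn !divE.
Qed.

Lemma pot_bad2 j : j < n -> potential (off 3 6 n + j) = a.+4.+1 + 2 * h.
Proof. by move=> jn; block. Qed.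

Lemma pot_good2 j : j < n ->
  potential (off 3 7 n + j) = a.+4.+1 + 2 * h + ~~ good_exit2 j.
Proof. by move=> jn; block; rewrite addKn. Qed.

Lemma pot_bad3 j : j < n -> potential (off 3 8 n + j) = a.+4.+2 + 2 * h.
Proof. by move=> jn; block. Qed.

Lemma pot_good3 j : j < n ->
  potential (off 3 9 n + j) = a.+4.+2 + 2 * h + ~~ good_end j.
Proof. by move=> jn; block; rewrite addKn. Qed.

Lemma pot_end x : x <= n * n ->
  potential (off 4 10 n - x) = a.+4.+3 + 2 * h + (a.+1 - x).
Proof.
move=> xn; have n0 : 0 < n by lia.
by block; rewrite subKn // /off; lia.
Qed.

Hypothesis no_triangle : ~~ triangle_at A n v z i.

Let not_good_end : good_end i = false.
Proof.
apply/negbTE; apply: contra no_triangle => /hasP[k kn /andP[/andP[ek zk] Aki]].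
apply/hasP; exists k => //; rewrite zk Aki !andbT.
by case/hasP: ek => j jn; rewrite -andbA => h'; apply/hasP; exists j.
Qed.

Lemma potential_fixed e : e \in fixed_edges A n ->
  (potential e.1 <= (potential e.2).+1) && (potential e.2 <= (potential e.1).+1).
Proof.
have n0 : 0 < n by lia.
have aE : a < n * n := cell_lt hn iN.
case/fixed_edgesP => [[x [j [xn jn]]]|[j jn]].
  have k := cell_lt xn jn.
  split_mem => /eqP-> /=.
  - by rewrite !pot_start; lia.
  - have -> : (off 3 10 n + (x * n + j)).+1 =
        off 4 10 n - (n * n - (x * n + j).+1) by rewrite /off; lia.
    have -> : off 3 10 n + (x * n + j) = off 4 10 n - (n * n - (x * n + j)).
      by rewrite /off; lia.
    by rewrite !pot_end; lia.
  - have -> : off 1 3 n + (x * n + j) = off 1 2 n + (x.+1 * n + j).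
      by rewrite /off; lia.
    rewrite !pot_chain1 //; last exact: ltnW.
    by have := chain_pot_step h x (A i j); lia.
  - have -> : off 2 6 n + (x * n + j) = off 2 5 n + (x.+1 * n + j).
      by rewrite /off; lia.
    rewrite !pot_chain2 //; last exact: ltnW.
    by have := chain_pot_step h x (good_entry j); lia.
  - have Axj : A x j <= 1 by case: (A x j).
    rewrite pot_row // pot_chain1 //; last lia.
    have := chain_pot_small h (A i j) Axj.
    case: (eqVneq x i) => [xi|_] /=; last by case: (A i j) => /=; lia.
    by rewrite xi; case: (A i j) => /=; lia.
  - have Axj : A x j <= 1 by case: (A x j).
    rewrite pot_good1 // pot_chain2 //; last lia.
    have := chain_pot_small h (good_entry j) Axj.
    case gx : (good_exit x) => /=; last by case: (good_entry j) => /=; lia.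
    case Ax : (A x j) => /=; last by lia.
    suff -> : good_entry j by rewrite /=; lia.
    by apply/hasP; exists x; rewrite ?mem_iota0 // gx.
  - rewrite pot_good2 //; case Ax : (A x j) => /=.
      have -> : off 3 8 n + (1 * n + j) = off 3 9 n + j by rewrite /off; lia.
      rewrite pot_good3 //; case gx : (good_exit2 x) => /=; last first.
        by case: (good_end j) => /=; lia.
      suff -> : good_end j by rewrite /=; lia.
      by apply/hasP; exists x; rewrite ?mem_iota0 // gx.
    by rewrite mul0n add0n pot_bad3 //; case: (good_exit2 x) => /=; lia.
split_mem => /eqP-> /=.
- by rewrite pot_bad1 // pot_good1 //; case: (good_exit j) => /=; lia.
- by rewrite pot_bad2 // pot_good2 //; case: (good_exit2 j) => /=; lia.
- by rewrite pot_bad3 // pot_good3 //; case: (good_end j) => /=; lia.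
Qed.

Lemma potential_link e : current_link n h i v z e ->
  (potential e.1 <= (potential e.2).+1) && (potential e.2 <= (potential e.1).+1).
Proof.
have n0 : 0 < n by lia.
have aE : a < n * n := cell_lt hn iN.
case=> x j => [b xn jn hx|b xn jn hx|xn jn ax|xn jn ax] /=;
  have k := cell_lt xn jn.
- have hx' : h <= x by case/orP: hx => [/ltnW //|/andP[/eqP-> _]].
  have -> : off 1 3 n + (x * n + j) = off 1 2 n + (x.+1 * n + j).
    by rewrite /off; lia.
  rewrite pot_chain1 //; have := chain_pot_exit (A i j) hx'.
  case: b hx => hx /=; last by rewrite mul0n add0n pot_bad1 //; lia.
  have -> : off 2 3 n + (1 * n + j) = off 2 4 n + j by rewrite /off; lia.
  rewrite pot_good1 // /good_exit.
  case/orP: hx => [->|/andP[_ /eqP <-]].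
    by case: (A i j); case: (v j) => /=; lia.
  by case: (A i j) => /=; case: (h < x) => /=; lia.
- have hx' : h <= x by case/orP: hx => [/ltnW //|/andP[/eqP-> _]].
  have -> : off 2 6 n + (x * n + j) = off 2 5 n + (x.+1 * n + j).
    by rewrite /off; lia.
  rewrite pot_chain2 //; have := chain_pot_exit (good_entry j) hx'.
  case: b hx => hx /=; last by rewrite mul0n add0n pot_bad2 //; lia.
  have -> : off 3 6 n + (1 * n + j) = off 3 7 n + j by rewrite /off; lia.
  rewrite pot_good2 // /good_exit2.
  case/orP: hx => [->|/andP[_ /eqP <-]].
    by case: (good_entry j); case: (z j) => /=; lia.
  by case: (good_entry j) => /=; case: (h < x) => /=; lia.
- rewrite pot_start ?pot_row //; last exact: ltnW.
  have [ji|ji] := eqVneq j i; first by rewrite /= /a; lia.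
  (* The cell with number [h * n + i] belongs to row [i], so a link of another row is attached
     strictly beyond it. *)
  have [eqx|] := eqVneq (h * n + i) (x * n + j).
    by have [_ ij] := cell_inj iN jn eqx; rewrite ij eqxx in ji.
  by rewrite /= /a; lia.
- rewrite pot_end ?pot_good3 //; last exact: ltnW.
  (* Here the absence of a triangle enters: otherwise the good arrival at [i] would have a value two
     below that of its current attachment on the path to t. *)
  have [ji|ji] := eqVneq j i; first by rewrite ji not_good_end /= /a; lia.
  have [eqx|] := eqVneq (h * n + i) (x * n + j).
    by have [_ ij] := cell_inj iN jn eqx; rewrite ij eqxx in ji.
  by case: (good_end j); rewrite /= /a; lia.
Qed.

Lemma no_triangle_walk directed E l :
  (forall e, e \in E -> e \in fixed_edges A n \/ current_link n h i v z e) ->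
  walk directed E 0 (off 4 10 n) l -> bound n h i <= l.
Proof.
move=> hE /(walk_potential (phi := potential)) hw.
have -> : bound n h i = potential (off 4 10 n).
  rewrite -[off 4 10 n]subn0 pot_end // subn0 /bound /a; lia.
have -> : l = potential 0 + l by rewrite pot_start.
by apply: hw => e /hE[/potential_fixed|/potential_link].
Qed.

End Potential.

(** Both walk bounds meet at [bound]. The output that stands for infinity is the number of vertices,
    which is at least [bound], so it is read as the absence of a triangle. *)
Lemma triangle_dist directed A n h i v z E r :
  h < n -> i < n -> {subset fixed_edges A n <= E} ->
  (forall e, current_link n h i v z e -> e \in E) ->
  (forall e, e \in E -> e \in fixed_edges A n \/ current_link n h i v z e) ->
  dist_answer directed (num_vertices n) 0 (off 4 10 n) E r ->
  (r < bound n h i) = triangle_at A n v z i.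
Proof.
move=> hn iN fE cE hE; have [tr|ntr] := boolP (triangle_at _ _ _ _ _).
  have wk := triangle_walk directed hn iN fE cE tr.
  case=> [[_ /(_ _ wk)]|[_ /(_ _ wk)]] //.
  by rewrite /bound; lia.
have lo l := no_triangle_walk hn iN ntr hE (directed := directed) (l := l).
move=> ans; apply/negbTE; rewrite -leqNgt.
case: ans => [[/lo //]|[-> _]].
have k := cell_lt hn iN.
by rewrite /bound /num_vertices /off; lia.
Qed.

(** * The sequence of requests *)

(* Time runs forwards in the decremental and backwards in the incremental
   case; the two request sequences are the time reversals of each other. *)
Definition clock (md : mode) (n t : nat) : nat :=
  if md is Incremental then n - t.+1 else t.

Definition is_dec (md : mode) : bool := if md is Decremental then true else false.

Definition mask_requests (n h : nat) (v z : nat -> bool) (b : bool) (j : nat) :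
    seq request :=
  [:: Update (mask1 n h j (v j (+) b)); Update (mask2 n h j (z j (+) b))].

Definition row_updates (n h i : nat) : seq request :=
  [:: Update (start_link n h i); Update (end_link n h i)].

(** The attachments of a row have to be present during its test: they are inserted just before it,
    or deleted just after it. *)
Definition row_requests (md : mode) (n h l : nat) : seq request :=
  if md is Incremental then rcons (row_updates n h (clock md n l)) Query
  else Query :: row_updates n h (clock md n l).

Definition iter_requests (F : nat -> seq request) (a b : nat) : seq request :=
  flatten [seq F j | j <- iota a (b - a)].

(** Before the row tests, the incremental case inserts the links that agree with the masks and the
    decremental case deletes those that disagree; the opposite links follow after the tests. Either
    way each link of time [h] is touched once and the tests see only the agreeing masks of that
    time. *)
Definition query_requests (md : mode) (n h : nat) (v z : nat -> bool) :
    seq request :=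
  iter_requests (mask_requests n h v z (is_dec md)) 0 n ++
  iter_requests (row_requests md n h) 0 n ++
  iter_requests (mask_requests n h v z (~~ is_dec md)) 0 n.

Fixpoint all_requests (md : mode) (n t : nat)
    (qs : seq ((nat -> bool) * (nat -> bool))) : seq request :=
  if qs is q :: qs' then
    query_requests md n (clock md n t) q.1 q.2 ++ all_requests md n t.+1 qs'
  else [::].

Definition updates (qs : seq request) : seq (nat * nat) :=
  flatten [seq if q is Update e then [:: e] else [::] | q <- qs].

Lemma updates_cat qs1 qs2 : updates (qs1 ++ qs2) = updates qs1 ++ updates qs2.
Proof. by rewrite /updates map_cat flatten_cat. Qed.

Lemma updates_iter F a b :
  updates (iter_requests F a b) =
  flatten [seq updates (F j) | j <- iota a (b - a)].
Proof.
by rewrite /iter_requests; elim: (iota _ _) => //= j s <-; rewrite updates_cat.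
Qed.

Lemma iter_requests_split F a b c : a <= b -> b <= c ->
  iter_requests F a c = iter_requests F a b ++ iter_requests F b c.
Proof.
move=> ab bc; rewrite /iter_requests -flatten_cat -map_cat.
have -> : c - a = (b - a) + (c - b) by lia.
by rewrite iotaD subnKC.
Qed.

Lemma iter_requestsS F a b : a < b ->
  iter_requests F a b = F a ++ iter_requests F a.+1 b.
Proof. by move=> ab; rewrite /iter_requests -[b - a]prednK ?subn_gt0 //= subnS. Qed.

Lemma iter_requests_last F a b : a <= b ->
  iter_requests F a b.+1 = iter_requests F a b ++ F b.
Proof.
move=> ab; rewrite (@iter_requests_split F a b) //; congr (_ ++ _).
by rewrite /iter_requests subSnn /= cats0.
Qed.

Lemma iter_requests_nil F a : iter_requests F a a = [::].
Proof. by rewrite /iter_requests subnn. Qed.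

Lemma mem_updates_iter F a b e :
  reflect (exists2 j, a <= j < b & e \in updates (F j))
    (e \in updates (iter_requests F a b)).
Proof.
rewrite updates_iter; apply: (iffP flatten_mapP) => -[j jab ej]; exists j => //.
  by move: jab; rewrite mem_iota; lia.
by rewrite mem_iota; lia.
Qed.

Lemma clock_lt md n t : t < n -> clock md n t < n.
Proof. by case: md => /=; lia. Qed.

Lemma clockK md n t : t < n -> clock md n (clock md n t) = t.
Proof. by case: md => /=; lia. Qed.

Lemma mem_updates_row md n h l e :
  (e \in updates (row_requests md n h l)) =
  (e \in [:: start_link n h (clock md n l); end_link n h (clock md n l)]).
Proof. by case: md. Qed.

Lemma mem_updates_query md n h v z e :
  reflect (exists2 j, j < n & e \in cell_links n h j)
    (e \in updates (query_requests md n h v z)).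
Proof.
rewrite !updates_cat !mem_cat; apply: (iffP or3P).
- case=> /mem_updates_iter[j /= jn].
  + rewrite !inE => ej; exists j => //; rewrite !inE.
    by case/orP: ej => /eqP->; case: (_ (+) _); rewrite eqxx ?orbT.
  + rewrite mem_updates_row !inE => ej; exists (clock md n j).
      exact: clock_lt.
    by rewrite !inE; case/orP: ej => /eqP->; rewrite eqxx ?orbT.
  + rewrite !inE => ej; exists j => //; rewrite !inE.
    by case/orP: ej => /eqP->; case: (_ (+) _); rewrite eqxx ?orbT.
case=> j jn.
have bits (b c : bool) : b = c (+) is_dec md \/ b = c (+) ~~ is_dec md.
  by case: b; case: c; case: md; (by left) || (by right).
have M1 b : e = mask1 n h j b ->
    [\/ e \in updates (iter_requests (mask_requests n h v z (is_dec md)) 0 n),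
        e \in updates (iter_requests (row_requests md n h) 0 n)
      | e \in updates (iter_requests (mask_requests n h v z (~~ is_dec md)) 0 n)].
  move=> ->; case: (bits b (v j)) => ->; [apply: Or31|apply: Or33];
    apply/mem_updates_iter; exists j; rewrite // !inE eqxx ?orbT //.
have M2 b : e = mask2 n h j b ->
    [\/ e \in updates (iter_requests (mask_requests n h v z (is_dec md)) 0 n),
        e \in updates (iter_requests (row_requests md n h) 0 n)
      | e \in updates (iter_requests (mask_requests n h v z (~~ is_dec md)) 0 n)].
  move=> ->; case: (bits b (z j)) => ->; [apply: Or31|apply: Or33];
    apply/mem_updates_iter; exists j; rewrite // !inE eqxx ?orbT //.
split_mem => /eqP eE; try (by apply: M1 eE); try (by apply: M2 eE);
  apply: Or32; apply/mem_updates_iter; exists (clock md n j);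
  by rewrite /= ?clock_lt // mem_updates_row clockK // !inE eE eqxx ?orbT.
Qed.

Lemma mem_updates_all md n t qs e :
  reflect (exists s j,
             [/\ t <= s < t + size qs, j < n & e \in cell_links n (clock md n s) j])
    (e \in updates (all_requests md n t qs)).
Proof.
elim: qs t => [|q qs IH] t /=; first by constructor=> -[s [j []]]; lia.
rewrite updates_cat mem_cat; apply: (iffP orP) => [[]|[s [j [st jn ej]]]].
- by case/mem_updates_query=> j jn ej; exists t, j; split=> //; lia.
- by case/IH=> s [j [st jn ej]]; exists s, j; split=> //; lia.
have [ts|ts] := eqVneq s t.
  by left; apply/mem_updates_query; exists j; rewrite -?ts.
by right; apply/IH; exists s, j; split=> //; lia.
Qed.

Lemma mem_all_requests md n qs : size qs = n ->
  updates (all_requests md n 0 qs) =i links n.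
Proof.
move=> sq e; apply/mem_updates_all/gridP.
  by case=> s [j [sn jn ej]]; exists (clock md n s), j; rewrite clock_lt //; lia.
case=> x [j [xn jn ej]]; exists (clock md n x), j.
by have := clock_lt md xn; rewrite clockK // sq => ?; split=> //; lia.
Qed.

Lemma size_iter_requests F c n : (forall x, size (F x) = c) ->
  size (iter_requests F 0 n) = n * c.
Proof. by move=> h; rewrite /iter_requests (size_flatten_iota _ _ h) subn0. Qed.

Lemma size_all_requests md n t qs :
  size (all_requests md n t qs) = size qs * (7 * n).
Proof.
elim: qs t => //= q qs IH t; rewrite !size_cat IH.
rewrite (@size_iter_requests (row_requests _ _ _) 3) => [|x];
  last by case: (md).
by rewrite !(@size_iter_requests _ 2) //; lia.
Qed.

Lemma size_updates_all md n t qs :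
  size (updates (all_requests md n t qs)) = size qs * (6 * n).
Proof.
elim: qs t => //= q qs IH t; rewrite !updates_cat !size_cat IH !updates_iter.
by rewrite !subn0 !(@size_flatten_iota _ _ 2) // => [|x]; [lia|case: (md)].
Qed.

(** Distinctness comes from counting: the updates have the same members as the duplicate-free list
    [links n] and the same length [6 * n * n]. *)
Lemma perm_updates_all md n qs : size qs = n ->
  perm_eq (updates (all_requests md n 0 qs)) (links n).
Proof.
move=> sq; have uL : uniq (links n).
  by have := uniq_edges (fun _ _ => false) n; rewrite cat_uniq => /and3P[].
have eqi := mem_all_requests md sq.
apply: uniq_perm => //; apply: leq_size_uniq uL _ _.
  by move=> e; rewrite eqi.
by rewrite size_updates_all size_links sq /off; lia.
Qed.

(** * Legality of the request sequence *)

Definition initial_edges (md : mode) (A : nat -> nat -> bool) (n : nat) :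
    seq (nat * nat) :=
  if md is Incremental then fixed_edges A n else fixed_edges A n ++ links n.

Lemma legal_incremental directed N m E qs :
  uniq (updates qs ++ E) -> all (is_edge directed N) (updates qs) ->
  size (updates qs ++ E) <= m -> legal directed Incremental N m E qs.
Proof.
elim: qs E => //= -[e|] qs IH E; last exact: IH.
rewrite -[updates _]/(e :: updates qs) /= size_cat mem_cat negb_or.
case/andP=> /andP[eU eE] u /andP[-> eqs] sm; rewrite eE /=.
apply/andP; split; first by lia.
apply: IH => //; last by rewrite size_cat /=; lia.
by rewrite -cat_rcons cat_uniq -cats1 -cat_uniq -catA uniq_catCA /= mem_cat
  negb_or eU eE.
Qed.

Lemma legal_decremental directed N m E qs :
  uniq E -> uniq (updates qs) -> {subset updates qs <= E} ->
  legal directed Decremental N m E qs.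
Proof.
elim: qs E => //= -[e|] qs IH E; last exact: IH.
rewrite -[updates _]/(e :: updates qs) /= => uE /andP[eU u] sE.
rewrite sE ?mem_head //=; apply: IH => //; first exact: rem_uniq.
move=> e' e'U; rewrite mem_rem_uniq // inE sE ?inE ?e'U ?orbT // andbT.
by apply: contraNneq eU => <-.
Qed.

Lemma mem_foldl_incremental E qs :
  foldl (next_graph Incremental) E qs =i updates qs ++ E.
Proof.
elim: qs E => //= -[e|] qs IH E e'; rewrite IH //.
by rewrite -[updates (_ :: _)]/(e :: updates qs) /= inE !mem_cat inE orbCA.
Qed.

Lemma mem_foldl_decremental E qs : uniq E ->
  foldl (next_graph Decremental) E qs =i [predD E & updates qs].
Proof.
elim: qs E => //= -[e|] qs IH E uE e'; rewrite IH ?rem_uniq //.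
rewrite -[updates (_ :: _)]/(e :: updates qs) !inE /= mem_rem_uniq // inE.
by rewrite negb_or -andbA andbCA.
Qed.

Lemma schedule_instance directed md A n qs : 0 < n -> size qs = n ->
  is_instance directed md (num_vertices n) (num_edges n) 0 (off 4 10 n)
    (initial_edges md A n) (all_requests md n 0 qs).
Proof.
move=> n0 sq; have pU := perm_updates_all md sq.
have uE := uniq_edges A n.
have edges : {in fixed_edges A n ++ links n, forall e,
    is_edge directed (num_vertices n) e}.
  move=> e /edge_bounds /andP[e12 eN]; rewrite /is_edge eN (ltn_trans e12) //=.
  by case: directed; rewrite ?neq_ltn e12.
have sE : size (fixed_edges A n ++ links n) = num_edges n.
  by rewrite size_cat size_fixed_edges size_links /num_edges /off; lia.
apply/and5P; split; last (apply/andP; split).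
- apply/andP; split; last first.
    by rewrite /initial_edges; case: md {pU} => //; move: uE; rewrite cat_uniq;
      case/and3P.
  apply/allP => e eE; apply: edges; rewrite mem_cat.
  by move: eE; rewrite /initial_edges; case: md {pU} => [->//|]; rewrite mem_cat.
- by rewrite /num_vertices.
- by rewrite /num_vertices.
- by rewrite /num_vertices /num_edges /off; nia.
- by case: md {pU}; rewrite /initial_edges ?sE // -sE size_cat leq_addr.
case: md pU => pU.
  apply: legal_incremental.
  - rewrite uniq_catC; move: uE.
    by rewrite -(perm_uniq (perm_cat (perm_refl (fixed_edges A n)) pU)).
  - by apply/allP => e; rewrite (perm_mem pU) => eL; apply: edges;
      rewrite mem_cat eL orbT.
  - by rewrite size_cat (perm_size pU) addnC -size_cat sE.
apply: legal_decremental => //.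
  by rewrite (perm_uniq pU); move: uE; rewrite cat_uniq => /and3P[].
by move=> e; rewrite (perm_mem pU) mem_cat => ->; rewrite orbT.
Qed.

(** * The graph at the moment of a test *)

Lemma all_requests_cat md n t qs1 qs2 :
  all_requests md n t (qs1 ++ qs2) =
  all_requests md n t qs1 ++ all_requests md n (t + size qs1) qs2.
Proof.
elim: qs1 t => [|q qs1 IH] t /=; first by rewrite addn0.
by rewrite IH catA addSnnS.
Qed.

(** Splits the lexicographic order of the moments [(h, i)] into later times, masks of the current
    time and remaining rows of the current time. These three groups match the segments of the
    request sequence. *)
Lemma current_linkE n h i v z e : h < n -> i < n ->
  current_link n h i v z e <->
  [\/ exists x j, [/\ h < x < n, j < n & e \in cell_links n x j],
      exists2 j, j < n & e \in [:: mask1 n h j (v j); mask2 n h j (z j)]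
    | exists2 j, i <= j < n & e \in [:: start_link n h j; end_link n h j]].
Proof.
move=> hn iN; split.
  have later x j : x < n -> j < n -> h * n + i <= x * n + j ->
      h < x \/ x = h /\ i <= j.
    move=> xn jn; case: (ltngtP h x) => [|xh|->]; [by left| |by right; lia].
    have : x.+1 * n <= h * n by rewrite leq_mul2r xh orbT.
    by rewrite mulSn; lia.
  case=> {e} x j.
  - move=> b xn jn /orP[hx|/andP[/eqP-> /eqP->]].
      apply: Or31; exists x, j; split; rewrite ?hx //.
      by rewrite !inE; case: b; rewrite eqxx ?orbT.
    by apply: Or32; exists j; rewrite // !inE eqxx.
  - move=> b xn jn /orP[hx|/andP[/eqP-> /eqP->]].
      apply: Or31; exists x, j; split; rewrite ?hx //.
      by rewrite !inE; case: b; rewrite eqxx ?orbT.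
    by apply: Or32; exists j; rewrite // !inE eqxx orbT.
  - move=> xn jn /(later _ _ xn jn)[hx|[-> ij]].
      apply: Or31; exists x, j; split; rewrite ?hx //.
      by rewrite !inE eqxx ?orbT.
    by apply: Or33; exists j; rewrite ?ij // !inE eqxx.
  - move=> xn jn /(later _ _ xn jn)[hx|[-> ij]].
      apply: Or31; exists x, j; split; rewrite ?hx //.
      by rewrite !inE eqxx ?orbT.
    by apply: Or33; exists j; rewrite ?ij // !inE eqxx orbT.
case=> [[x [j [/andP[hx xn] jn]]]|[j jn]|[j /andP[ij jn]]].
- have le : h * n + i <= x * n + j.
    have : h.+1 * n <= x * n by rewrite leq_mul2r hx orbT.
    by rewrite mulSn; lia.
  by split_mem => /eqP->; constructor; rewrite ?hx.
- by split_mem => /eqP->; constructor; rewrite ?eqxx ?orbT.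
- by split_mem => /eqP->; constructor; rewrite // leq_add2l.
Qed.

Lemma all_requests_at md n qs1 v z qs2 l :
  l < n ->
  let h := clock md n (size qs1) in
  all_requests md n 0 (qs1 ++ (v, z) :: qs2) =
  (all_requests md n 0 qs1 ++
   iter_requests (mask_requests n h v z (is_dec md)) 0 n ++
   iter_requests (row_requests md n h) 0 l) ++
  (iter_requests (row_requests md n h) l n ++
   iter_requests (mask_requests n h v z (~~ is_dec md)) 0 n ++
   all_requests md n (size qs1).+1 qs2).
Proof.
move=> ln h; rewrite all_requests_cat /= /query_requests -/h.
rewrite [in LHS](@iter_requests_split (row_requests md n h) 0 l n) ?(ltnW ln) //.
by rewrite -!catA.
Qed.

(** The links present at a test are the updates already made in the incremental case and the updates
    still to come in the decremental case. Both sets are those of [current_link]. *)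
Lemma test_answer directed md A n qs1 v z qs2 l r :
  size (qs1 ++ (v, z) :: qs2) = n -> l < n ->
  let h := clock md n (size qs1) in
  let done := all_requests md n 0 qs1 ++
    iter_requests (mask_requests n h v z (is_dec md)) 0 n ++
    iter_requests (row_requests md n h) 0 l ++
    (if md is Incremental then row_updates n h (clock md n l) else [::]) in
  dist_answer directed (num_vertices n) 0 (off 4 10 n)
    (foldl (next_graph md) (initial_edges md A n) done) r ->
  (r < bound n h (clock md n l)) = triangle_at A n v z (clock md n l).
Proof.
move=> sq ln h done.
have tn : size qs1 < n by rewrite -sq size_cat /=; lia.
have hn : h < n by exact: clock_lt.
have iN := clock_lt md ln; set i := clock md n l in iN *.
have sq2 : size qs2 = n - (size qs1).+1 by move: sq; rewrite size_cat /=; lia.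
suff [mE] : {subset fixed_edges A n <=
      foldl (next_graph md) (initial_edges md A n) done} /\
    (forall e, current_link n h i v z e \/ e \in fixed_edges A n <->
       e \in foldl (next_graph md) (initial_edges md A n) done).
  move=> cE; apply: triangle_dist => // e.
    by move=> ce; apply/cE; left.
  by case/cE; [right|left].
(* The bit [false] stands for the links that agree with the masks; they belong to [done] when links
   are inserted and to the rest when links are deleted. *)
have mask0 e : (e \in updates (iter_requests (mask_requests n h v z false) 0 n))
    <-> exists2 j, j < n & e \in [:: mask1 n h j (v j); mask2 n h j (z j)].
  by split=> [/mem_updates_iter[j jn ej]|[j jn ej]]; last apply/mem_updates_iter;
    exists j => //; move: ej; rewrite /mask_requests !addbF.
have pU := perm_updates_all md sq; have uE := uniq_edges A n.
have rows e a b : (e \in updates (iter_requests (row_requests md n h) a b))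
    <-> exists2 j, a <= j < b & e \in [:: start_link n h (clock md n j);
                                         end_link n h (clock md n j)].
  by split=> [/mem_updates_iter[j jn ej]|[j jn ej]]; last apply/mem_updates_iter;
    exists j => //; move: ej; rewrite mem_updates_row.
case: md @h @done hn mask0 @i iN pU rows => h done hn mask0 i iN pU rows.
- have mem e : (e \in foldl (next_graph Incremental) (fixed_edges A n) done) =
      (e \in updates done) || (e \in fixed_edges A n).
    by rewrite mem_foldl_incremental mem_cat.
  split=> e; rewrite mem; first by move->; rewrite orbT.
  suff cE : current_link n h i v z e <-> e \in updates done.
    by split=> [[/cE->|->]|/orP[/cE|]]; rewrite ?orbT //; [left|right].
  rewrite current_linkE // /done !updates_cat !mem_cat.
  split=> [[[x [j [hx jn ej]]]|/mask0->|[j ij ej]]|].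
  + apply/orP; left; apply/mem_updates_all; exists (clock Incremental n x), j.
    by rewrite clockK; [split=> //|]; move: hx; rewrite /h /=; lia.
  + by rewrite !orbT.
  + have [ji|ji] := eqVneq j i.
      by apply/or4P; apply: Or44; move: ej; rewrite ji !inE orbF.
    apply/or4P; apply: Or43; apply/rows; exists (clock Incremental n j).
      by move: ij ji; rewrite /i /=; lia.
    by rewrite clockK //; lia.
  case/or4P=> [/mem_updates_all[s [j [st jn ej]]]|/mask0 ?|/rows[j jl ej]|ej].
  + apply: Or31; exists (clock Incremental n s), j; split=> //.
    by rewrite /h /=; lia.
  + exact: Or32.
  + apply: Or33; exists (clock Incremental n j) => //.
    by rewrite /i /=; lia.
  + apply: Or33; exists i; first by rewrite leqnn.
    by move: ej; rewrite !inE orbF.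
- set rest := iter_requests (row_requests Decremental n h) l n ++
    iter_requests (mask_requests n h v z false) 0 n ++
    all_requests Decremental n (size qs1).+1 qs2.
  have allE : all_requests Decremental n 0 (qs1 ++ (v, z) :: qs2) = done ++ rest.
    by rewrite (all_requests_at _ _ _ _ _ ln) /done cats0.
  (* Since no link is deleted twice, the surviving links are exactly those that the remaining
     requests will delete. *)
  have uA : uniq (fixed_edges A n ++ updates done ++ updates rest).
    by rewrite -updates_cat -allE (perm_uniq (perm_cat (perm_refl _) pU)).
  have mem e : (e \in foldl (next_graph Decremental)
        (fixed_edges A n ++ links n) done) =
      (e \in updates rest) || (e \in fixed_edges A n).
    rewrite mem_foldl_decremental // inE /= -(perm_mem (perm_cat (perm_refl _) pU)).
    rewrite allE updates_cat; move: (fixed_edges A n) uA => F; rewrite !mem_cat.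
    rewrite uniq_catCA cat_uniq => /and3P[_ /hasPn dis _].
    case: (boolP (e \in updates done)) => [ed|_] /=.
      apply/esym/negbTE; apply/negP => eR; move: (dis e); rewrite mem_cat orbC eR.
      by rewrite ed => /(_ isT).
    by rewrite orbC.
  split=> e; rewrite mem; first by move->; rewrite orbT.
  suff cE : current_link n h i v z e <-> e \in updates rest.
    by split=> [[/cE->|->]|/orP[/cE|]]; rewrite ?orbT //; [left|right].
  rewrite current_linkE // /rest !updates_cat !mem_cat.
  split=> [[[x [j [hx jn ej]]]|/mask0->|[j ij ej]]|].
  + apply/or3P; apply: Or33; apply/mem_updates_all; exists x, j.
    by split=> //; move: hx; rewrite /h /=; lia.
  + by rewrite !orbT.
  + by apply/or3P; apply: Or31; apply/rows; exists j.
  case/or3P=> [/rows[j jl ej]|/mask0 ?|/mem_updates_all[s [j [st jn ej]]]].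
  + by apply: Or33; exists j.
  + exact: Or32.
  + by apply: Or31; exists s, j; split=> //; rewrite /h /=; lia.
Qed.

(** * Loops and calls *)

(** A frame condition on own variables and own arrays. Temporaries and simulated memory are left
    free; the latter is tracked by [building] and [live]. *)
Definition same_but (X : seq nat) (st st' : state) : Prop :=
  (forall y, y < first_tmp -> y \notin X -> reg st' y = reg st y) /\
  forall a i, a < arr_shift -> arr st' a i = arr st a i.

Lemma same_but_refl X st : same_but X st st.
Proof. by []. Qed.

Lemma same_but_trans X Y st1 st2 st3 :
  same_but X st1 st2 -> same_but Y st2 st3 -> {subset X <= Y} ->
  same_but Y st1 st3.
Proof.
move=> [r1 a1] [r2 a2] XY; split=> [y yF yY|a i aA]; last by rewrite a2 ?a1.
by rewrite r2 ?r1 //; apply: contra yY; apply: XY.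
Qed.

Lemma same_but_sub X Y st st' :
  same_but X st st' -> {subset X <= Y} -> same_but Y st st'.
Proof. by move=> h XY; apply: same_but_trans h (same_but_refl _ _) XY. Qed.

Lemma own_persistent y : y < first_tmp -> persistent y.
Proof. by rewrite /persistent => ->. Qed.

Lemma shifted_persistent x : persistent (x + reg_shift).
Proof. by rewrite /persistent leq_addl orbT. Qed.

Lemma shifted_neq x y : x < first_tmp -> (y + reg_shift == x) = false.
Proof. by rewrite /first_tmp /reg_shift; lia. Qed.

Lemma writes_reg_but x v st st' : writes_reg x v st st' -> same_but [:: x] st st'.
Proof.
case=> a r; split=> [y yF|b i bA]; last by rewrite a.
by rewrite inE => yx; rewrite r ?own_persistent // (negbTE yx).
Qed.

Lemma same_own_but X st st' : same_own st st' -> same_but X st st'.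
Proof. by case=> r a; split=> // y yF _; apply: r. Qed.

Lemma writes_reg_embeds x v sg st st' : x < first_tmp ->
  writes_reg x v st st' -> embeds sg st -> embeds sg st'.
Proof.
move=> xF [a r] [er ea]; split=> [y|b i]; last by rewrite a.
by rewrite r ?shifted_persistent // shifted_neq.
Qed.

Lemma writes_reg_id x st : writes_reg x (reg st x) st st.
Proof. by split=> // y _; case: eqP => [->|]. Qed.

(* [J k B tau st] includes a bound of the elapsed time [tau] by the budget
   [B]. *)
Lemma wp_for_budget w x body n X C (J : nat -> nat -> nat -> state -> Prop)
    (Q : nat -> state -> Prop) B tau st0 :
  x < first_tmp -> x != 2 -> 2 \notin X -> x \notin X -> n < 2 ^ w -> 0 < w ->
  reg st0 2 = n ->
  (forall k B tau st st' v d, J k B tau st -> writes_reg x v st st' ->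
     J k (B + d) (tau + d) st') ->
  J 0 B tau st0 ->
  (forall k B tau st, k < n -> J k B tau st -> reg st x = k ->
     same_but (x :: X) st0 st ->
     wp w body (fun tau' st' => J k.+1 (B + C) tau' st' /\ same_but X st st')
       tau st) ->
  (forall tau' st', J n (B + (n * (C + 4) + 3)) tau' st' ->
     same_but (x :: X) st0 st' -> Q tau' st') ->
  wp w (for_loop x body) Q tau st0.
Proof.
move=> xF x2 nX xX nw w0 st2 Jstab J0 hb hQ.
pose I k tau st := J k (B + (k * (C + 4) + 2)) tau st /\ same_but (x :: X) st0 st.
have x_sub : {subset [:: x] <= x :: X} by move=> y; rewrite !inE => ->.
have X_sub : {subset X <= x :: X} by move=> y yX; rewrite inE yX orbT.
apply: (wp_for (I := I) (n := n)) => //.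
- move=> st' wr; split; first exact: Jstab J0 wr.
  exact: same_but_sub (writes_reg_but wr) x_sub.
- move=> k tau1 st1 kn [J1 o1] xk n1.
  apply: wp_mono (hb _ _ _ _ kn J1 xk o1) => tau2 st3 [J2 o2].
  split=> [||st4 wr].
  + by case: o2 => -> //.
  + by case: o2 => -> //.
  split.
    have -> : B + (k.+1 * (C + 4) + 2) = B + (k * (C + 4) + 2) + C + 4 by lia.
    exact: Jstab J2 wr.
  have o3 := same_but_trans o1 (same_but_sub o2 X_sub) (fun _ h => h).
  exact: same_but_trans o3 (same_but_sub (writes_reg_but wr) x_sub) _.
move=> tau1 st1 [J1 o1]; apply: hQ => //.
have -> : B + (n * (C + 4) + 3) = B + (n * (C + 4) + 2) + 1 by lia.
(* The exit test takes one step and changes nothing; it is treated as writing the present value of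
   [x], so that the stability of [J] applies. *)
by rewrite -[tau1.+1]addn1; apply: Jstab J1 (writes_reg_id x st1).
Qed.

(** * Writing the input of the simulated preprocessing *)

(** Array [arr_shift] is the input array of the simulated algorithm, and register 4 is the next free
    position in it. *)
Definition emit (e : expr) : cmd :=
  Seq (store arr_shift (EReg 4) e) (assign 4 (EAdd (EReg 4) (ENat 1))).

Definition emit_cost (e : expr) : nat := cost e + 9.

Fixpoint emit_pairs (ps : seq (expr * expr)) : cmd :=
  if ps is p :: ps' then Seq (emit p.1) (Seq (emit p.2) (emit_pairs ps'))
  else Skip.

Definition pairs_cost (ps : seq (expr * expr)) : nat :=
  foldr (fun p c => emit_cost p.1 + emit_cost p.2 + c) 1 ps.

Definition words_of (es : seq (nat * nat)) : seq nat :=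
  flatten [seq edge_words e | e <- es].

Lemma words_of_cat es1 es2 : words_of (es1 ++ es2) = words_of es1 ++ words_of es2.
Proof. by rewrite /words_of map_cat flatten_cat. Qed.

Lemma size_words_of es : size (words_of es) = 2 * size es.
Proof. by elim: es => //= e es; rewrite /words_of /= => ->; lia. Qed.

(** The preprocessing is specified from [state0], so all simulated memory other than the input under
    construction must still be zero. *)
Definition building (ws : seq nat) (st : state) : Prop :=
  [/\ reg st 4 = size ws,
      forall a j, arr st (a + arr_shift) j = if a == 0 then nth 0 ws j else 0
    & forall x, reg st (x + reg_shift) = 0].

Lemma writes_reg_building x v ws st st' : x < first_tmp -> x != 4 ->
  writes_reg x v st st' -> building ws st -> building ws st'.
Proof.
move=> xF x4 [a r] [b1 b2 b3]; split=> [|b j|y].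
- by rewrite r // eq_sym (negbTE x4).
- by rewrite a.
- by rewrite r ?shifted_persistent // shifted_neq.
Qed.

Lemma wp_emit w e (Q : nat -> state -> Prop) tau st ws :
  fits e -> no_underflow st e -> eval st e < 2 ^ w -> (size ws).+1 < 2 ^ w ->
  building ws st ->
  (forall st', building (rcons ws (eval st e)) st' -> same_but [:: 4] st st' ->
     Q (tau + emit_cost e) st') ->
  wp w (emit e) Q tau st.
Proof.
move=> fe ue be bs [b1 b2 b3] hQ; apply: wp_seq.
apply: wp_store => //; first by rewrite /= b1 ltnW.
move=> st1 [a1 r1]; apply: wp_assign => //; rewrite /= ?r1 ?b1 ?addn1 //.
move=> st2 [a2 r2]; have -> : tau + (2 + (cost e).+1) + (2 + 2 + 2) =
    tau + emit_cost e by rewrite /emit_cost; lia.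
apply: hQ.
- split=> [|a j|x].
  + by rewrite r2 // size_rcons.
  + rewrite a2 a1 /= b1 -[X in _ == X]add0n eqn_add2r b2 nth_rcons.
    by case: (a == 0) => //=; case: (ltngtP j (size ws)) => // js;
      rewrite nth_default // ltnW.
  + by rewrite r2 ?shifted_persistent // shifted_neq // r1 ?shifted_persistent.
- split=> [y yF|a i aA].
    by rewrite inE => y4; rewrite r2 ?own_persistent // (negbTE y4) r1
      ?own_persistent.
  by rewrite a2 a1; case: eqP => // aE; rewrite aE in aA.
Qed.

Definition good_pair (st : state) (w : nat) (p : expr * expr) : Prop :=
  [/\ no_underflow st p.1, no_underflow st p.2,
      eval st p.1 < 2 ^ w & eval st p.2 < 2 ^ w].

(** Register 4 advances with every word that is emitted. Expressions that avoid it keep the value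
    they have before the first word, which is what [wp_emit_pairs] speaks of. *)
Definition pair_ok (p : expr * expr) : bool :=
  [&& fits p.1, fits p.2, 4 \notin vars p.1 & 4 \notin vars p.2].

Lemma fits_agree e st st' : fits e -> 4 \notin vars e ->
  (forall y, y < first_tmp -> y != 4 -> reg st' y = reg st y) ->
  (forall y, reg_shift <= y -> reg st' y = reg st y) ->
  {in vars e, forall y, reg st' y = reg st y}.
Proof.
move=> /andP[/allP ve _] n4 h1 h2 y ye.
case/orP: (ve y ye) => [yF|/h2//]; apply: h1 => //.
by apply: contraNneq n4 => <-.
Qed.

Lemma wp_emit_pairs w ps (Q : nat -> state -> Prop) tau st ws :
  all pair_ok ps -> (forall p, List.In p ps -> good_pair st w p) ->
  size ws + 2 * size ps < 2 ^ w ->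
  building ws st ->
  (forall st', building (ws ++ words_of
      [seq (eval st p.1, eval st p.2) | p <- ps]) st' ->
     same_but [:: 4] st st' -> Q (tau + pairs_cost ps) st') ->
  wp w (emit_pairs ps) Q tau st.
Proof.
elim: ps tau st ws => [|[e1 e2] ps IH] tau st ws /=.
  by move=> _ _ _ b hQ; apply: wp_skip; rewrite -[tau.+1]addn1; apply: hQ; rewrite ?cats0.
case/andP=> /and4P[/= f1 f2 n1 n2] ok good sz b hQ.
have [/= u1 u2 b1 b2] := good (e1, e2) (or_introl erefl).
have zero st' ws' : building ws' st' ->
    forall y, reg_shift <= y -> reg st' y = 0.
  by case=> _ _ h y yR; rewrite -(subnK yR).
have agree st' ws' : building ws' st' -> same_but [:: 4] st st' ->
    forall e, fits e -> 4 \notin vars e ->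
    {in vars e, forall y, reg st' y = reg st y}.
  move=> B' o' e fe ne; apply: fits_agree => // y.
    by move=> yF y4; case: o' => -> //; rewrite inE.
  by move=> yR; rewrite (zero _ _ B') // (zero _ _ b).
apply: wp_seq; apply: (wp_emit f1 u1 b1 _ b) => [|st1 B1 o1]; first by lia.
have e2E := eval_agree (agree _ _ B1 o1 _ f2 n2).
apply: wp_seq; apply: (wp_emit f2 _ _ _ B1) => [|||st2 B2 o2].
- exact: no_underflow_agree (agree _ _ B1 o1 _ f2 n2) u2.
- by rewrite e2E.
- by rewrite size_rcons; lia.
have o12 : same_but [:: 4] st st2 by apply: same_but_trans o1 o2 _.
have ag2 p : List.In p ps ->
    (eval st2 p.1 = eval st p.1) * (eval st2 p.2 = eval st p.2) *
    (good_pair st2 w p).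
  move=> pin; have [u3 u4 b3 b4] := good p (or_intror pin).
  have : pair_ok p.
    by elim: (ps) ok pin => //= p' s h /andP[? ?] [<-//|]; apply: h.
  case/and4P=> f3 f4 n3 n4.
  have a3 := agree _ _ B2 o12 _ f3 n3; have a4 := agree _ _ B2 o12 _ f4 n4.
  rewrite (eval_agree a3) (eval_agree a4); split=> //; split.
  - exact: no_underflow_agree a3 u3.
  - exact: no_underflow_agree a4 u4.
  - by rewrite (eval_agree a3).
  - by rewrite (eval_agree a4).
apply: (IH _ _ _ ok _ _ B2).
- by move=> p /ag2[].
- by rewrite !size_rcons; lia.
move=> st3 B3 o3; have -> : tau + emit_cost e1 + emit_cost e2 + pairs_cost ps =
    tau + (emit_cost e1 + emit_cost e2 + pairs_cost ps) by lia.
apply: hQ; last exact: same_but_trans o12 o3 _.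
move: B3; rewrite e2E -!cats1 -!catA.
suff -> : [seq (eval st2 p.1, eval st2 p.2) | p <- ps] =
  [seq (eval st p.1, eval st p.2) | p <- ps] by [].
elim: (ps) ag2 => //= p s h hp; rewrite h => [|q qs]; last by apply: hp; right.
by have [[-> ->] _] := hp p (or_introl erefl).
Qed.

Lemma wp_build_loop w x body n F C X ws tau (Q : nat -> state -> Prop) st0 :
  x < first_tmp -> x != 2 -> x != 4 -> 2 \notin X -> x \notin X ->
  n < 2 ^ w -> 0 < w -> reg st0 2 = n -> building ws st0 ->
  (forall k tau st ws', k < n -> building ws' st -> reg st x = k ->
     same_but (x :: X) st0 st ->
     size ws' + 2 * size (F k) <=
       size ws + 2 * size (flatten [seq F j | j <- iota 0 n]) ->
     wp w body (fun tau' st' => [/\ building (ws' ++ words_of (F k)) st',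
       tau' <= tau + C & same_but X st st']) tau st) ->
  (forall tau' st', building
       (ws ++ words_of (flatten [seq F j | j <- iota 0 n])) st' ->
     tau' <= tau + (n * (C + 4) + 3) -> same_but (x :: X) st0 st' ->
     Q tau' st') ->
  wp w (for_loop x body) Q tau st0.
Proof.
move=> xF x2 x4 nX xX nw w0 st2 b0 hb hQ.
pose J k B tau1 st := building
  (ws ++ words_of (flatten [seq F j | j <- iota 0 k])) st /\ tau1 <= B.
apply: (wp_for_budget (n := n) (J := J) (X := X) (C := C) (B := tau)) => //.
- move=> k B tau1 st st' v d [b tB] wr; split; last by rewrite leq_add2r.
  exact: writes_reg_building wr b.
- by rewrite /J /= cats0.
- move=> k B tau1 st kn [b tB] xk o.
  have sz : size (flatten [seq F j | j <- iota 0 k]) + size (F k) <=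
      size (flatten [seq F j | j <- iota 0 n]).
    have -> : n = k + (n - k.+1).+1 by lia.
    rewrite iotaD map_cat flatten_cat -[iota (0 + k) _]/(k :: iota k.+1 _).
    by rewrite !size_cat leq_add2l leq_addr.
  have sz' : size (ws ++ words_of (flatten [seq F j | j <- iota 0 k])) +
      2 * size (F k) <= size ws + 2 * size (flatten [seq F j | j <- iota 0 n]).
    by rewrite size_cat size_words_of; lia.
  apply: wp_mono (hb _ tau1 _ _ kn b xk o sz') => tau2 st' [b' t' o'].
  split=> //; split; last by apply: leq_trans t' _; rewrite leq_add2r.
  by rewrite -addn1 iotaD map_cat flatten_cat words_of_cat catA /= cats0.
by move=> tau1 st' [b' t'] o'; apply: hQ.
Qed.

(** * Calls of the simulated update and query procedures *)

Section Serving.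
Variables (directed : bool) (md : mode) (D : sp_algorithm) (w N s t : nat).
Variable E0 : seq (nat * nat).

(** The time [T] of all remaining requests is charged to the budget in advance. Serving a request
    moves time from [T] to [tau] and leaves [B] alone; own steps raise [tau] and [B] together. In
    this way an amortized bound is used without any bound on a single call. *)
Definition live (done rest : seq request) (B tau : nat) (st : state) : Prop :=
  exists sg T, [/\ embeds sg st,
    serves w (sp_proc D) request_words (next_graph md)
      (request_ok directed N s t) (foldl (next_graph md) E0 done) rest sg T
    & tau + T <= B].

Lemma live_writes_reg done rest B tau st st' x v d : x < first_tmp ->
  live done rest B tau st -> writes_reg x v st st' ->
  live done rest (B + d) (tau + d) st'.
Proof.
move=> xF [sg [T [em sv tB]]] wr; exists sg, T; split=> //; last by lia.
exact: writes_reg_embeds wr em.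
Qed.

Lemma live_same_persistent done rest B tau st st' d :
  live done rest B tau st -> same_persistent st st' ->
  live done rest (B + d) (tau + d) st'.
Proof.
move=> [sg [T [[e1 e2] sv tB]]] [a r]; exists sg, T; split=> //; last by lia.
by split=> [x|b i]; rewrite ?a // r ?shifted_persistent.
Qed.

Definition send (p : expr * expr) : cmd :=
  Seq (store arr_shift (ENat 0) p.1) (Seq (store arr_shift (ENat 1) p.2)
    (Seq (assign reg_shift (ENat 2)) (shift_cmd (sp_update D)))).

Definition send_cost (p : expr * expr) : nat := cost p.1 + cost p.2 + 7.

Lemma same_ownI st st' :
  (forall y, persistent y -> y != reg_shift -> reg st' y = reg st y) ->
  (forall a i, a < arr_shift -> arr st' a i = arr st a i) -> same_own st st'.
Proof.
move=> r a; split=> // y yF; apply: r; first exact: own_persistent.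
by rewrite /first_tmp /reg_shift in yF *; lia.
Qed.

Lemma wp_send p e (Q : nat -> state -> Prop) done rest B tau st :
  2 < 2 ^ w -> fits p.1 -> fits p.2 -> good_pair st w p ->
  (eval st p.1, eval st p.2) = e ->
  live done (Update e :: rest) B tau st ->
  (forall tau' st', live (rcons done (Update e)) rest (B + send_cost p) tau' st' ->
     same_own st st' -> Q tau' st') ->
  wp w (send p) Q tau st.
Proof.
move=> w2 f1 f2 [u1 u2 b1 b2] <- [sg [T [[er ea] sv tB]]] hQ.
have b0 : 0 < 2 ^ w by lia.
have b1' : 1 < 2 ^ w by lia.
apply: wp_seq; apply: wp_store => // st1 [a1 r1].
have e2E : eval st1 p.2 = eval st p.2.
  by apply: eval_eq => //; case/andP: f2.
apply: wp_seq; apply: wp_store => //.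
- by apply: no_underflow_eq u2 => //; case/andP: f2.
- by rewrite e2E.
move=> st2 [a2 r2]; apply: wp_seq; apply: wp_assign => // st3 [a3 r3].
set ev := (eval st p.1, eval st p.2) in sv hQ *.
(* Taking apart the given service of the whole sequence yields the run for the next request and the
   service of the others. *)
inversion sv as [|E1 q1 qs1 sg1 t1 sg' T' [t' t1E run] ok sv']; subst.
have em3 : embeds (with_input w (edge_words ev) sg) st3.
  split=> [x|a i] /=.
    rewrite r3 ?shifted_persistent //= -{2}[reg_shift]add0n eqn_add2r.
    case: (x == 0); first by rewrite /wrap modn_small.
    by rewrite r2 ?r1 ?shifted_persistent.
  rewrite a3 a2 a1 -{2 4}[arr_shift]add0n eqn_add2r e2E /=.
  case: (a =P 0) => [->|_] /=; last exact: ea.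
  by case: i => [|[|i]] //=; rewrite /wrap ?modn_small // -ea.
have [st' [run' em' own]] := shift_runs run em3.
exists t', st'; split=> //; apply: hQ.
  exists sg', T'; split=> //; first by rewrite foldl_rcons.
  by move: tB; rewrite /send_cost /=; lia.
apply: same_own_trans own; apply: same_ownI => [y py yR|a i aA].
  by rewrite r3 // (negbTE yR) r2 ?r1.
by rewrite a3 a2 a1; case: eqP => // aE; rewrite aE in aA.
Qed.

Definition ask : cmd := Seq (assign reg_shift (ENat 0)) (shift_cmd (sp_query D)).

Lemma wp_ask (Q : nat -> state -> Prop) done rest B tau st :
  live done (Query :: rest) B tau st ->
  (forall tau' st', live (rcons done Query) rest (B + 2) tau' st' ->
     same_own st st' ->
     dist_answer directed N s t (foldl (next_graph md) E0 done)
       (reg st' (1 + reg_shift)) ->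
     Q tau' st') ->
  wp w ask Q tau st.
Proof.
move=> [sg [T [[er ea] sv tB]]] hQ.
apply: wp_seq; apply: wp_assign => //; first by rewrite /= expn_gt0.
move=> st3 [a3 r3].
inversion sv as [|E1 q1 qs1 sg1 t1 sg' T' [t' t1E run] ok sv']; subst.
have em3 : embeds (with_input w [::] sg) st3.
  split=> [x|a i] /=.
    rewrite r3 ?shifted_persistent //= -{2}[reg_shift]add0n eqn_add2r.
    by case: (x == 0); rewrite /wrap ?mod0n.
  by rewrite a3 ltn0 andbF.
have [st' [run' em' own]] := shift_runs run em3.
exists t', st'; split=> //; apply: hQ.
- exists sg', T'; split=> //; first by rewrite foldl_rcons.
  by move: tB; rewrite /=; lia.
- apply: same_own_trans own; apply: same_ownI => [y py yR|a i aA].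
    by rewrite r3 // (negbTE yR).
  by rewrite a3.
- by case: em' => -> _.
Qed.

End Serving.

(** * The reduction *)

(* Register 2 holds [n], 3 the number of queries answered so far, 4 the length
   of the input written for the simulated algorithm, 5 and 6 are loop counters,
   7 holds the time [h], 8 the row [i], 9 and 10 bits of the input. *)

Definition edim : expr := EReg 2.
Definition eoff (a b : nat) : expr :=
  EAdd (EMul (ENat a) (EMul edim edim)) (EMul (ENat b) edim).
Definition ecell (x j : expr) : expr := EAdd (EMul x edim) j.

Definition mask1_expr (x j b : expr) : expr * expr :=
  (EAdd (eoff 1 3) (ecell x j), EAdd (eoff 2 3) (ecell b j)).
Definition mask2_expr (x j b : expr) : expr * expr :=
  (EAdd (eoff 2 6) (ecell x j), EAdd (eoff 3 6) (ecell b j)).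
Definition start_expr (x j : expr) : expr * expr :=
  (ecell x j, EAdd (eoff 1 1) j).
Definition end_expr (x j : expr) : expr * expr :=
  (EAdd (eoff 3 9) j, ESub (eoff 4 10) (ecell x j)).

Definition header_exprs : seq (expr * expr) :=
  [:: (EAdd (eoff 4 10) (ENat 1), eoff 13 3); (ENat 0, eoff 4 10)].

Definition cell_exprs : seq (expr * expr) :=
  let x := EReg 5 in let j := EReg 6 in let k := ecell x j in
  [:: (k, EAdd k (ENat 1));
      (EAdd (eoff 3 10) k, EAdd (EAdd (eoff 3 10) k) (ENat 1));
      (EAdd (eoff 1 2) k, EAdd (eoff 1 3) k);
      (EAdd (eoff 2 5) k, EAdd (eoff 2 6) k);
      (EAdd (eoff 1 1) x, EAdd (eoff 1 2) (ecell (EReg 9) j));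
      (EAdd (eoff 2 4) x, EAdd (eoff 2 5) (ecell (EReg 9) j));
      (EAdd (eoff 3 7) x, EAdd (eoff 3 8) (ecell (EReg 9) j))].

Definition column_exprs : seq (expr * expr) :=
  let j := EReg 6 in
  [:: (EAdd (eoff 2 3) j, EAdd (eoff 2 4) j);
      (EAdd (eoff 3 6) j, EAdd (eoff 3 7) j);
      (EAdd (eoff 3 8) j, EAdd (eoff 3 9) j)].

Definition link_exprs : seq (expr * expr) :=
  let x := EReg 5 in let j := EReg 6 in
  [:: mask1_expr x j (ENat 0); mask1_expr x j (ENat 1);
      mask2_expr x j (ENat 0); mask2_expr x j (ENat 1);
      start_expr x j; end_expr x j].

Definition prep_cmd (md : mode) (D : sp_algorithm) : cmd :=
  Seq (load 2 0 (ENat 0)) (Seq (emit_pairs header_exprs)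
  (Seq (for_loop 5 (for_loop 6
     (Seq (load 9 0 (EAdd (ENat 1) (ecell (EReg 5) (EReg 6))))
        (emit_pairs cell_exprs))))
  (Seq (for_loop 6 (emit_pairs column_exprs))
  (Seq (if md is Incremental then Skip
        else for_loop 5 (for_loop 6 (emit_pairs link_exprs)))
  (Seq (assign reg_shift (EReg 4)) (shift_cmd (sp_prep D))))))).

(** * Correctness and cost of the preprocessing *)

Fixpoint sub_free (e : expr) : bool :=
  match e with
  | ENat _ | EReg _ => true
  | EAdd e1 e2 | EMul e1 e2 => sub_free e1 && sub_free e2
  | ESub _ _ => false
  end.

Lemma sub_free_no_underflow st e : sub_free e -> no_underflow st e.
Proof. by elim: e => //= e1 h1 e2 h2 /andP[/h1 ? /h2]. Qed.

(** Ample room for every number in use: vertices, positions in the graph input, which has at most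
    [4 + 2 * num_edges n] words, and [bound]. *)
Definition wide (w n : nat) : Prop := 100 * (n * n) + 100 <= 2 ^ w.

Lemma wide_word w n : wide w n -> 0 < w.
Proof. by case: w => //; rewrite /wide expn0; lia. Qed.

Lemma edge_wide w n A e : 0 < n -> wide w n ->
  e \in fixed_edges A n ++ links n -> (e.1 < 2 ^ w) && (e.2 < 2 ^ w).
Proof.
by move=> n0 wd /edge_bounds; move: wd; rewrite /wide /num_vertices /off; nia.
Qed.

(** That values fit into a word follows from their being endpoints of edges of the graph, so no
    expression needs an estimate of its own. *)
Lemma good_pairs st w n A ps es :
  0 < n -> wide w n ->
  [seq (eval st p.1, eval st p.2) | p <- ps] = es ->
  {subset es <= fixed_edges A n ++ links n} ->
  (forall p, List.In p ps -> no_underflow st p.1 /\ no_underflow st p.2) ->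
  forall p, List.In p ps -> good_pair st w p.
Proof.
move=> n0 wd esE sub un p pin; have [u1 u2] := un p pin.
have pE : (eval st p.1, eval st p.2) \in es.
  rewrite -esE; elim: (ps) pin => //= p' s h [->|/h]; rewrite inE ?eqxx //.
  by move->; rewrite orbT.
by have /andP[b1 b2] := edge_wide n0 wd (sub _ pE); split.
Qed.

Lemma cell_exprsE st (A : nat -> nat -> bool) n x j :
  reg st 2 = n -> reg st 5 = x -> reg st 6 = j -> reg st 9 = A x j ->
  [seq (eval st p.1, eval st p.2) | p <- cell_exprs] = cell_edges A n x j.
Proof. by move=> r2 r5 r6 r9; rewrite /= r2 r5 r6 r9 !addn1. Qed.

Lemma column_exprsE st n j : reg st 2 = n -> reg st 6 = j ->
  [seq (eval st p.1, eval st p.2) | p <- column_exprs] = column_edges n j.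
Proof. by move=> r2 r6; rewrite /= r2 r6. Qed.

Lemma link_exprsE st n x j : reg st 2 = n -> reg st 5 = x -> reg st 6 = j ->
  [seq (eval st p.1, eval st p.2) | p <- link_exprs] = cell_links n x j.
Proof. by move=> r2 r5 r6; rewrite /= r2 r5 r6. Qed.

Lemma end_expr_underflow st x j n : reg st 2 = n ->
  eval st x < n -> eval st j < n -> sub_free x -> sub_free j ->
  no_underflow st (end_expr x j).1 /\ no_underflow st (end_expr x j).2.
Proof.
move=> r2 xn jn sx sj; have k := cell_lt xn jn.
split; first by apply: sub_free_no_underflow; rewrite /= sj.
split; try by apply: sub_free_no_underflow; rewrite /= ?sx ?sj.
by rewrite /= r2; lia.
Qed.

Lemma link_exprs_underflow st n : reg st 2 = n -> reg st 5 < n ->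
  reg st 6 < n ->
  forall p, List.In p link_exprs -> no_underflow st p.1 /\ no_underflow st p.2.
Proof.
move=> r2 r5 r6 p; do 5 (case=> [<-|]; first by split;
  apply: sub_free_no_underflow).
by case=> [<-|[]]; apply: (end_expr_underflow r2).
Qed.

Definition prep_cost : nat :=
  pairs_cost header_exprs + pairs_cost cell_exprs + pairs_cost column_exprs +
  pairs_cost link_exprs + 100.

Lemma sub_free_pairs st ps :
  all (fun p => sub_free p.1 && sub_free p.2) ps ->
  forall p, List.In p ps -> no_underflow st p.1 /\ no_underflow st p.2.
Proof.
elim: ps => //= p ps IH /andP[/andP[s1 s2] /IH h] q [<-|/h//].
by split; apply: sub_free_no_underflow.
Qed.

Lemma building_wrap ws sg st w :
  all (fun x => x < 2 ^ w) ws -> size ws < 2 ^ w ->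
  building ws st -> writes_reg reg_shift (reg st 4) st sg ->
  embeds (with_input w ws state0) sg.
Proof.
move=> /allP bw bs [b1 b2 b3] [a r]; split=> [x|b i] /=.
  rewrite r ?shifted_persistent // -{2}[reg_shift]add0n eqn_add2r b1.
  by case: (x == 0) => //; rewrite /wrap modn_small.
rewrite a b2; case: (b == 0) => //=; case: ltnP => iw; last exact: nth_default.
by rewrite /wrap modn_small //; apply/bw/mem_nth.
Qed.

Lemma loop1_le c n : 0 < n -> n * (c + 4) + 3 <= (c + 7) * (n * n).
Proof.
move=> n0; have nn : n <= n * n by rewrite leq_pmull.
have : n * c <= n * n * c by rewrite leq_mul2r nn orbT.
by rewrite !mulnDl !mulnDr [c * _]mulnC; lia.
Qed.

Lemma loop2_le c n : 0 < n ->
  n * (n * (c + 4) + 3 + 4) + 3 <= (c + 14) * (n * n).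
Proof.
move=> n0; have nn : n <= n * n by rewrite leq_pmull.
by rewrite !mulnDl !mulnDr !mulnA [n * n * c]mulnC; lia.
Qed.

Lemma prep_time n h c1 c2 c3 t2 t3 t4 t5 : 0 < n -> t2 <= 10 + h ->
  t3 <= t2 + (n * (n * (c1 + 20 + 4) + 3 + 4) + 3) ->
  t4 <= t3 + (n * (c2 + 4) + 3) ->
  t5 <= t4 + (n * (n * (c3 + 4) + 3 + 4) + 3) ->
  t5 + 10 <= (h + c1 + c2 + c3 + 100) * (n * n).
Proof.
move=> n0 h2 h3 h4 h5.
have l1 := loop2_le (c1 + 20) n0; have l2 := loop1_le c2 n0.
have l3 := loop2_le c3 n0; have nn1 : 0 < n * n by rewrite muln_gt0 n0.
have : h <= h * (n * n) by rewrite leq_pmulr.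
by rewrite !mulnDl in l1 l2 l3 *; lia.
Qed.

Lemma prep_correct md D w n (A : nat -> nat -> bool) sg tp st :
  0 < n -> wide w n ->
  call w (sp_prep D) (graph_words (num_vertices n) (num_edges n) 0 (off 4 10 n)
    (initial_edges md A n)) state0 tp sg ->
  building [::] st -> arr st 0 0 = n ->
  (forall x j, x < n -> j < n -> arr st 0 (1 + (x * n + j)) = A x j) ->
  exists t st', [/\ runs w (prep_cmd md D) st t st', embeds sg st',
    reg st' 2 = n, reg st' 3 = reg st 3 & t <= prep_cost * (n * n) + tp].
Proof.
move=> n0 wd [tD tpE run] b0 in0 inA.
have w0 := wide_word wd; have nw : n < 2 ^ w.
  by move: wd; rewrite /wide; nia.
have w1 : 1 < 2 ^ w by exact: word_gt1.
have fixed_sub : {subset fixed_edges A n <= fixed_edges A n ++ links n}.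
  by move=> e ee; rewrite mem_cat ee.
have links_sub : {subset links n <= fixed_edges A n ++ links n}.
  by move=> e ee; rewrite mem_cat ee orbT.
suff : wp w (prep_cmd md D) (fun t st' => [/\ embeds sg st', reg st' 2 = n,
    reg st' 3 = reg st 3 & t <= prep_cost * (n * n) + tp]) 0 st.
  by case=> t [st' [r [e r2 r3 tt]]]; exists t, st'; split.
apply: wp_seq; apply: wp_load => // [|st1 wr1]; first by rewrite /= expn_gt0.
have b1 := writes_reg_building (isT : 2 < first_tmp) isT wr1 b0.
have o1 := writes_reg_but wr1.
have n1 : reg st1 2 = n by case: wr1 => _ -> //=.
have inA1 x j : x < n -> j < n -> arr st1 0 (1 + (x * n + j)) = A x j.
  by move=> xn jn; case: o1 => _ -> //; apply: inA.
apply: wp_seq; apply: (wp_emit_pairs _ _ _ b1) => //.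
- move=> p pin; have [u1 u2] := @sub_free_pairs st1 header_exprs isT p pin.
  split=> //; case: pin => [<-|[<-|//]] /=; rewrite ?n1 ?expn_gt0 //;
    move: wd; rewrite /wide; nia.
- by rewrite /=; move: wd; rewrite /wide; nia.
rewrite cat0s.
set ws2 := words_of _; have ws2E : ws2 = [:: num_vertices n; num_edges n; 0; off 4 10 n].
  by rewrite /ws2 /= n1 addn1.
move=> st2 b2 o2; have n2 : reg st2 2 = n by case: o2 => -> //.
have inA2 x j : x < n -> j < n -> arr st2 0 (1 + (x * n + j)) = A x j.
  by move=> xn jn; case: o2 => _ -> //; apply: inA1.
have sz2 : size ws2 = 4 by rewrite ws2E.
have szE : 4 + 2 * size (fixed_edges A n ++ links n) < 2 ^ w.
  rewrite size_cat size_fixed_edges size_links; move: wd.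
  by rewrite /wide /off; nia.
move: szE; rewrite size_cat => szE.
apply: wp_seq.
apply: (@wp_build_loop w 5 _ n
  (fun x => flatten [seq cell_edges A n x j | j <- iota 0 n])
  (* The summand 20 covers loading the matrix entry. *)
  (n * (pairs_cost cell_exprs + 20 + 4) + 3) [:: 6; 9; 4] ws2) => //.
  move=> x tau3 st3 ws3 xn b3 x3 o3 sz3.
  have n3 : reg st3 2 = n by case: o3 => -> //.
  apply: (@wp_build_loop w 6 _ n (cell_edges A n x)
    (pairs_cost cell_exprs + 20) [:: 9; 4] ws3) => //.
  move=> j tau4 st4 ws4 jn b4 j4 o4 sz4.
  have n4 : reg st4 2 = n by case: o4 => -> //.
  have x4 : reg st4 5 = x by case: o4 => -> //.
  have k := cell_lt xn jn.
  have ev : eval st4 (EAdd (ENat 1) (ecell (EReg 5) (EReg 6))) = 1 + (x * n + j).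
    by rewrite /= n4 x4 j4.
  apply: wp_seq; apply: wp_load; rewrite ?ev //.
    by move: wd; rewrite /wide; lia.
  move=> st5 wr5.
  have a5 : arr st4 0 (1 + (x * n + j)) = A x j.
    by case: o4 => _ -> //; case: o3 => _ -> //; apply: inA2.
  rewrite a5 in wr5; have b5 := writes_reg_building (isT : 9 < first_tmp) isT wr5 b4.
  have cE : [seq (eval st5 p.1, eval st5 p.2) | p <- cell_exprs] =
      cell_edges A n x j.
    by apply: cell_exprsE; case: wr5 => _ -> //=; rewrite ?n4 ?x4 ?j4.
  apply: (wp_emit_pairs _ _ _ b5) => //.
  - apply: (good_pairs (A := A) n0 wd cE); last exact: sub_free_pairs.
    by move=> e ee; apply/fixed_sub/fixed_edgesP; left; exists x, j.
  - have -> : size cell_exprs = size (cell_edges A n x j) by [].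
    apply: leq_ltn_trans sz4 _; apply: leq_ltn_trans sz3 _.
    apply: leq_ltn_trans szE; rewrite sz2 leq_add2l leq_mul2l /=.
    by rewrite size_cat -addnA leq_addr.
  rewrite cE => st6 b6 o6; split=> //.
    by rewrite -addnA leq_add2l addnC leq_add2l.
  apply: same_but_trans (same_but_sub (writes_reg_but wr5) _)
    (same_but_sub o6 _) (fun _ h => h).
    by move=> y; rewrite !inE => ->.
  by move=> y; rewrite !inE => ->; rewrite orbT.
move=> tau3 st3 b3 t3 o3; have n3 : reg st3 2 = n by case: o3 => -> //.
apply: wp_seq.
apply: (@wp_build_loop w 6 _ n (column_edges n)
  (pairs_cost column_exprs) [:: 4] _ _ _ _ _ _ _ _ _ _ _ n3 b3) => //.
  move=> j tau4 st4 ws4 jn b4 j4 o4 sz4.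
  have n4 : reg st4 2 = n by case: o4 => -> //.
  have cE := column_exprsE n4 j4.
  apply: (wp_emit_pairs _ _ _ b4) => //.
  - apply: (good_pairs (A := A) n0 wd cE); last exact: sub_free_pairs.
    by move=> e ee; apply/fixed_sub/fixed_edgesP; right; exists j.
  - have -> : size column_exprs = size (column_edges n j) by [].
    apply: leq_ltn_trans sz4 _; apply: leq_ltn_trans szE.
    by rewrite size_cat size_words_of /fixed_edges size_cat sz2 /grid; lia.
  by rewrite cE => st6 b6 o6; split.
move=> tau4 st4; rewrite -catA -words_of_cat -/(fixed_edges A n) => b4 t4 o4.
have n4 : reg st4 2 = n by case: o4 => -> //.
have r34 : reg st4 3 = reg st 3.
  by case: o4 => -> //; case: o3 => -> //; case: o2 => -> //; case: o1 => -> //.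
(* The common end of both modes. The time bound allows for the loop over the links even in the
   incremental case, where that loop is absent. *)
have fin ws tau5 st5 : ws = words_of (initial_edges md A n) ->
    building (ws2 ++ ws) st5 -> same_but [:: 5; 6; 4] st4 st5 ->
    tau5 <= tau4 + (n * (n * (pairs_cost link_exprs + 4) + 3 + 4) + 3) ->
    wp w (Seq (assign reg_shift (EReg 4)) (shift_cmd (sp_prep D)))
      (fun t st' => [/\ embeds sg st', reg st' 2 = n,
        reg st' 3 = reg st 3 & t <= prep_cost * (n * n) + tp]) tau5 st5.
  move=> wsE b5 o5 t5.
  have gw : ws2 ++ ws = graph_words (num_vertices n) (num_edges n) 0
      (off 4 10 n) (initial_edges md A n) by rewrite ws2E wsE.
  have szG : size (ws2 ++ ws) < 2 ^ w.
    apply: leq_ltn_trans szE; rewrite size_cat sz2 wsE size_words_of leq_add2l.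
    by rewrite leq_mul2l /= /initial_edges; case: (md); rewrite ?size_cat ?leq_addr.
  have bw : all (fun x => x < 2 ^ w) (ws2 ++ ws).
    rewrite all_cat wsE; apply/andP; split.
      rewrite ws2E /= expn_gt0 /= andbT /num_vertices /num_edges /off.
      by move: wd; rewrite /wide; nia.
    apply/allP => y /flatten_mapP[e eI].
    have /andP[e1 e2] : (e.1 < 2 ^ w) && (e.2 < 2 ^ w).
      apply: (edge_wide n0 wd (A := A)); move: eI; rewrite /initial_edges.
      by case: (md) => //; apply: fixed_sub.
    by rewrite !inE => /orP[]/eqP->.
  apply: wp_seq; apply: wp_assign => //.
    by case: b5 => /= ->.
  move=> st6 wr6.
  have em := building_wrap bw szG b5 wr6; rewrite gw in em.
  have [st' [run' em' [own _]]] := shift_runs run em.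
  exists tD, st'; split=> //.
  have own6 y : y < first_tmp -> y \notin [:: 5; 6; 4] -> reg st' y = reg st4 y.
    move=> yF yX; rewrite own //; case: wr6 => _ ->; last exact: own_persistent.
    rewrite ifN; last by rewrite /first_tmp /reg_shift in yF *; lia.
    by case: o5 => ->.
  split=> //; rewrite ?own6 //.
  have t2 : 0 + (cost (ENat 0) + 1) + pairs_cost header_exprs <=
      10 + pairs_cost header_exprs by rewrite leq_add2r.
  have := prep_time n0 t2 t3 t4 t5; rewrite tpE -/prep_cost.
  by move: (prep_cost * _) => c; rewrite [cost _]/=; clear; lia.
apply: wp_seq; case: md fin {run tpE} => fin.
  apply: wp_skip; apply: (fin _ _ _ erefl b4 (same_but_refl _ _)).
  by rewrite -addn1 leq_add2l addnC.
apply: (@wp_build_loop w 5 _ n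
  (fun x => flatten [seq cell_links n x j | j <- iota 0 n])
  (n * (pairs_cost link_exprs + 4) + 3) [:: 6; 4] _ _ _ _ _ _ _ _ _ _ _ n4 b4) => //.
  move=> x tau5 st5 ws5 xn b5 x5 o5 sz5.
  have n5 : reg st5 2 = n by case: o5 => -> //.
  apply: (@wp_build_loop w 6 _ n (cell_links n x)
    (pairs_cost link_exprs) [:: 4] ws5) => //.
  move=> j tau6 st6 ws6 jn b6 j6 o6 sz6.
  have n6 : reg st6 2 = n by case: o6 => -> //.
  have x6 : reg st6 5 = x by case: o6 => -> //.
  have cE := link_exprsE n6 x6 j6.
  apply: (wp_emit_pairs _ _ _ b6) => //.
  - apply: (good_pairs (A := A) n0 wd cE).
      by move=> e ee; apply/links_sub/gridP; exists x, j.
    by apply: (link_exprs_underflow n6); rewrite ?x6 ?j6.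
  - have -> : size link_exprs = size (cell_links n x j) by [].
    apply: leq_ltn_trans sz6 _; apply: leq_ltn_trans sz5 _.
    apply: leq_ltn_trans szE.
    by rewrite size_cat size_words_of sz2 /links /grid; lia.
  by rewrite cE => st7 b7 o7; split.
move=> tau5 st5; rewrite -catA -words_of_cat => b5 t5 o5.
exact: (fin _ _ _ erefl b5 o5 t5).
Qed.

(** * Answering one OMv3 query *)

Definition eclock (md : mode) (e : expr) : expr :=
  if md is Incremental then ESub edim (EAdd e (ENat 1)) else e.

Definition ebit (b : bool) (r : nat) : expr :=
  if b then ESub (ENat 1) (EReg r) else EReg r.

Definition ebound : expr :=
  EAdd (EAdd (EMul (ENat 2) (ecell (EReg 7) (EReg 8))) (EMul (ENat 2) (EReg 7)))
    (ENat 8).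

Definition mask_body (D : sp_algorithm) (b : bool) : cmd :=
  Seq (load 9 0 (EAdd edim (EReg 5)))
  (Seq (load 10 0 (EAdd (EAdd edim edim) (EReg 5)))
  (Seq (send D (mask1_expr (EReg 7) (EReg 5) (ebit b 9)))
       (send D (mask2_expr (EReg 7) (EReg 5) (ebit b 10))))).

Definition row_sends (D : sp_algorithm) : cmd :=
  Seq (send D (start_expr (EReg 7) (EReg 8)))
      (send D (end_expr (EReg 7) (EReg 8))).

(** The distance is requested whether or not the bit of u at row [i] is set, since the requests must
    be those fixed in [all_requests]; the bit is consulted only afterwards. Register [1 + reg_shift]
    is the simulated output. *)
Definition test_body (D : sp_algorithm) : cmd :=
  Seq (ask D) (Seq (load 9 0 (EReg 8))
    (if_less (1 + reg_shift) ebound (If 9 (assign 1 (ENat 1)) Skip) Skip)).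

Definition row_body (md : mode) (D : sp_algorithm) : cmd :=
  Seq (assign 8 (eclock md (EReg 5)))
    (if md is Incremental then Seq (row_sends D) (test_body D)
     else Seq (test_body D) (row_sends D)).

Definition query_cmd (md : mode) (D : sp_algorithm) : cmd :=
  Seq (assign 7 (eclock md (EReg 3)))
  (Seq (assign 1 (ENat 0))
  (Seq (for_loop 5 (mask_body D (is_dec md)))
  (Seq (for_loop 5 (row_body md D))
  (Seq (for_loop 5 (mask_body D (~~ is_dec md)))
    (assign 3 (EAdd (EReg 3) (ENat 1))))))).

Definition mask_cost (b : bool) : nat :=
  send_cost (mask1_expr (EReg 7) (EReg 5) (ebit b 9)) +
  send_cost (mask2_expr (EReg 7) (EReg 5) (ebit b 10)) + 20.

Definition row_cost : nat :=
  send_cost (start_expr (EReg 7) (EReg 8)) +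
  send_cost (end_expr (EReg 7) (EReg 8)) + 60.

Lemma eclock_eval md st e n : reg st 2 = n -> eval st e < n -> sub_free e ->
  eval st (eclock md e) = clock md n (eval st e) /\
  no_underflow st (eclock md e).
Proof.
move=> r2 en se; have ue := sub_free_no_underflow st se.
by case: md => //=; rewrite r2 addn1.
Qed.

Lemma ebit_eval b r st (c : bool) : reg st r = c ->
  eval st (ebit b r) = c (+) b /\ no_underflow st (ebit b r).
Proof. by move=> rc; case: b => /=; rewrite rc; case: c {rc}. Qed.

Section Query.
Variables (directed : bool) (md : mode) (D : sp_algorithm) (w N s t n : nat).
Variable E0 : seq (nat * nat).
Variables (u v z : nat -> bool) (h : nat).
Hypotheses (n0 : 0 < n) (wd : wide w n) (hn : h < n).

Let w0 : 0 < w := wide_word wd.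
Let w2 : 2 < 2 ^ w. Proof. by move: wd; rewrite /wide; lia. Qed.
Let nw : n < 2 ^ w. Proof. by move: wd; rewrite /wide; nia. Qed.

Let lv := live directed md D w N s t E0.

Definition query_input (st : state) : Prop :=
  forall j, j < n -> [/\ arr st 0 j = u j, arr st 0 (n + j) = v j
                       & arr st 0 (n + n + j) = z j].

Lemma live_mono done rest B B' tau st : B <= B' ->
  lv done rest B tau st -> lv done rest B' tau st.
Proof.
by move=> BB [sg [T [e sv tB]]]; exists sg, T; split=> //; apply: leq_trans BB.
Qed.

Lemma wp_send_edge p e (Q : nat -> state -> Prop) done rest B tau st :
  fits p.1 -> fits p.2 -> no_underflow st p.1 -> no_underflow st p.2 ->
  (eval st p.1, eval st p.2) = e -> e \in links n ->
  lv done (Update e :: rest) B tau st ->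
  (forall tau' st', lv (rcons done (Update e)) rest (B + send_cost p) tau' st' ->
     same_own st st' -> Q tau' st') ->
  wp w (send D p) Q tau st.
Proof.
move=> f1 f2 u1 u2 eE eL l hQ.
have eW : e \in fixed_edges (fun _ _ => false) n ++ links n.
  by rewrite mem_cat eL orbT.
have /andP[b1 b2] := edge_wide n0 wd eW; rewrite -eE /= in b1 b2.
exact: (wp_send w2 f1 f2 _ eE l hQ).
Qed.

Lemma mem_links x j e : x < n -> j < n -> e \in cell_links n x j -> e \in links n.
Proof. by move=> xn jn ee; apply/gridP; exists x, j. Qed.

Lemma wp_mask_body b done rest B tau st j (Q : nat -> state -> Prop) :
  reg st 2 = n -> reg st 7 = h -> reg st 5 = j -> j < n -> query_input st ->
  lv done (mask_requests n h v z b j ++ rest) B tau st ->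
  (forall tau' st', lv (done ++ mask_requests n h v z b j) rest
       (B + mask_cost b) tau' st' ->
     same_but [:: 9; 10] st st' -> Q tau' st') ->
  wp w (mask_body D b) Q tau st.
Proof.
move=> r2 r7 r5 jn inp l hQ; have [_ iv iz] := inp j jn.
have k := cell_lt hn jn.
apply: wp_seq; apply: wp_load => //=; rewrite r2 r5.
  by move: wd; rewrite /wide; nia.
rewrite iv => st1 wr1.
have r1 y : y < first_tmp -> y != 9 -> reg st1 y = reg st y.
  by move=> yF y9; case: wr1 => _ ->; rewrite ?own_persistent // (negbTE y9).
apply: wp_seq; apply: wp_load => //=; rewrite !r1 // r2 r5.
  by move: wd; rewrite /wide; nia.
case: (wr1) => -> _; rewrite iz => st2 wr2.
have r2' y : y < first_tmp -> y != 9 -> y != 10 -> reg st2 y = reg st y.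
  move=> yF y9 y10; case: wr2 => _ ->; rewrite ?own_persistent //.
  by rewrite (negbTE y10) r1.
have r9 : reg st2 9 = v j by case: wr2 => _ -> //=; case: wr1 => _ -> //.
have r10 : reg st2 10 = z j by case: wr2 => _ -> //=.
have [e9 u9] := ebit_eval b r9.
have [e10 u10] := ebit_eval b r10.
have l2 := live_writes_reg 9 (isT : 10 < first_tmp)
  (live_writes_reg 6 (isT : 9 < first_tmp) l wr1) wr2.
apply: wp_seq.
apply: (wp_send_edge (e := mask1 n h j (v j (+) b)) _ _ _ _ _ _ l2).
- by [].
- by case: (b).
- exact: sub_free_no_underflow.
- by [].
- by rewrite /mask1 -e9 /= !r2' // r2 r7 r5.
- by apply: (mem_links hn jn); rewrite !inE; case: (_ (+) _); rewrite eqxx ?orbT.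
move=> tau3 st3 l3 o3.
have r3 y : y < first_tmp -> y != 9 -> y != 10 -> reg st3 y = reg st y.
  by move=> yF y9 y10; case: o3 => -> // _; apply: r2'.
have [e10' u10'] := @ebit_eval b 10 st3 (z j) (etrans (proj1 o3 10 isT) r10).
apply: (wp_send_edge (e := mask2 n h j (z j (+) b)) _ _ _ _ _ _ l3).
- by [].
- by case: (b).
- exact: sub_free_no_underflow.
- by [].
- by rewrite /mask2 -e10' /= !r3 // r2 r7 r5.
- by apply: (mem_links hn jn); rewrite !inE; case: (_ (+) _); rewrite eqxx ?orbT.
move=> tau4 st4 l4 o4; apply: hQ.
  move: l4; rewrite -!cats1 -catA; apply: live_mono.
  by rewrite /mask_cost; lia.
have o2 : same_but [:: 9; 10] st st2.
  split=> [y yF|a i aA].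
    by rewrite !inE negb_or => /andP[y9 y10]; apply: r2'.
  by case: wr2 => -> _; case: wr1 => -> _.
exact: same_but_trans o2 (same_own_but [:: 9; 10] (same_own_trans o3 o4))
  (fun _ h => h).
Qed.

Lemma wp_mask_loop b done rest B tau st (Q : nat -> state -> Prop) :
  reg st 2 = n -> reg st 7 = h -> query_input st ->
  lv done (iter_requests (mask_requests n h v z b) 0 n ++ rest) B tau st ->
  (forall tau' st', lv (done ++ iter_requests (mask_requests n h v z b) 0 n) rest
       (B + (n * (mask_cost b + 4) + 3)) tau' st' ->
     same_but [:: 5; 9; 10] st st' -> Q tau' st') ->
  wp w (for_loop 5 (mask_body D b)) Q tau st.
Proof.
move=> r2 r7 inp l hQ; set F := mask_requests n h v z b.
pose J k := lv (done ++ iter_requests F 0 k) (iter_requests F k n ++ rest).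
apply: (wp_for_budget (n := n) (J := J) (X := [:: 9; 10]) (C := mask_cost b)
  (B := B)) => //.
- by move=> k B1 tau1 st1 st2 x d; apply: live_writes_reg.
- by rewrite /J iter_requests_nil cats0.
- move=> k B1 tau1 st1 kn l1 r5 o1.
  have r21 : reg st1 2 = n by case: o1 => -> //.
  have r71 : reg st1 7 = h by case: o1 => -> //.
  apply: (wp_mask_body r21 r71 r5 kn).
  + by move=> j jn; case: o1 => _ o1; rewrite !o1 //; apply: inp.
  + by move: l1; rewrite /J (iter_requestsS _ kn) -catA; apply.
  + by move=> tau2 st2 l2 o2; split=> //; rewrite /J iter_requests_last // catA.
- by move=> tau1 st1; rewrite /J iter_requests_nil; apply: hQ.
Qed.

Lemma wp_test_body done rest B tau st i (acc tr : bool)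
    (Q : nat -> state -> Prop) :
  reg st 2 = n -> reg st 7 = h -> reg st 8 = i -> i < n -> query_input st ->
  reg st 1 = acc ->
  (forall r, dist_answer directed N s t (foldl (next_graph md) E0 done) r ->
     (r < bound n h i) = tr) ->
  lv done (Query :: rest) B tau st ->
  (forall tau' st', lv (rcons done Query) rest (B + 50) tau' st' ->
     same_but [:: 9; 1] st st' -> reg st' 1 = acc || (u i && tr) :> nat ->
     Q tau' st') ->
  wp w (test_body D) Q tau st.
Proof.
move=> r2 r7 r8 iN inp r1 ans l hQ; have [iu _ _] := inp i iN.
have k := cell_lt hn iN.
apply: wp_seq; apply: (wp_ask l) => tau1 st1 l1 [o1 a1] /ans trE.
apply: wp_seq; apply: wp_load => //=; rewrite o1 // r8.
  by move: nw; lia.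
rewrite a1 // iu => st2 wr2.
have l2 := live_writes_reg (3) (isT : 9 < first_tmp) l1 wr2.
have p41 : persistent (1 + reg_shift) by exact: shifted_persistent.
have r41 : reg st2 (1 + reg_shift) = reg st1 (1 + reg_shift).
  by case: wr2 => _ ->.
have r2' y : y < first_tmp -> y != 9 -> reg st2 y = reg st y.
  by move=> yF y9; case: wr2 => _ ->; rewrite ?own_persistent // (negbTE y9) o1.
have eb : eval st2 ebound = bound n h i by rewrite /= !r2' // r2 r7 r8.
apply: wp_if_less => //; rewrite ?eb.
- by move: wd; rewrite /bound /wide; nia.
move=> st3 sp; rewrite r41 trE.
have l3 := live_same_persistent 30 l2 sp.
have r9 : reg st3 9 = u i by case: sp => _ -> //; case: wr2 => _ ->.
have r3 y : y < first_tmp -> y != 9 -> reg st3 y = reg st y.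
  by move=> yF y9; case: sp => _ -> //; [exact: r2'|exact: own_persistent].
have ao3 a j : a < arr_shift -> arr st3 a j = arr st a j.
  by move=> aA; case: sp => -> _; case: wr2 => -> _; apply: a1.
have o3 : same_but [:: 9; 1] st st3.
  by split=> // y yF; rewrite !inE negb_or => /andP[y9 _]; apply: r3.
have cE : cost ebound + 2 <= 30 by [].
have keep tau' : tau' <= tau1 + 3 + 40 -> reg st3 1 = acc || (u i && tr) :> nat ->
    Q tau' st3.
  move=> t' r31; apply: hQ => //; case: l3 => sg [T [em sv tB]].
  by exists sg, T; split=> //; lia.
have small : tau1 + (cost (EReg 8) + 1) + (cost ebound + 2) <= tau1 + 3 + 30.
  by rewrite [cost (EReg 8)]/=; lia.
move: small; move: (tau1 + _ + _) => tau2 small.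
case trE' : tr.
  apply: wp_if; rewrite r9; case uE : (u i) => /=.
    apply: wp_assign => //=; first exact: word_gt1.
    move=> st4 wr4; apply: hQ.
    - have [sg [T [em sv tB]]] := l3; exists sg, T; split=> //; last by lia.
      exact: writes_reg_embeds wr4 em.
    - apply: same_but_trans o3 (same_but_sub (writes_reg_but wr4) _) _ => //.
      by move=> y; rewrite !inE => ->; rewrite orbT.
    - by case: wr4 => _ -> //=; rewrite uE trE' orbT.
  by apply: wp_skip; apply: keep; [lia|rewrite r3 // uE orbF].
by apply: wp_skip; apply: keep; [lia|rewrite r3 // trE' andbF orbF].
Qed.

Lemma wp_row_sends done rest B tau st i (Q : nat -> state -> Prop) :
  reg st 2 = n -> reg st 7 = h -> reg st 8 = i -> i < n ->
  lv done (row_updates n h i ++ rest) B tau st ->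
  (forall tau' st', lv (done ++ row_updates n h i) rest
       (B + (send_cost (start_expr (EReg 7) (EReg 8)) +
             send_cost (end_expr (EReg 7) (EReg 8)))) tau' st' ->
     same_own st st' -> Q tau' st') ->
  wp w (row_sends D) Q tau st.
Proof.
move=> r2 r7 r8 iN l hQ.
apply: wp_seq; apply: (wp_send_edge (e := start_link n h i) _ _ _ _ _ _ l) => //.
- by rewrite /= r2 r7 r8.
- by apply: (mem_links hn iN); rewrite !inE eqxx ?orbT.
move=> tau1 st1 l1 o1; case: (o1) => r1 _.
have [u1 u2] : no_underflow st1 (end_expr (EReg 7) (EReg 8)).1 /\
    no_underflow st1 (end_expr (EReg 7) (EReg 8)).2.
  by apply: (@end_expr_underflow _ _ _ n); rewrite ?r1 //= ?r1 ?r7 ?r8.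
apply: (wp_send_edge (e := end_link n h i) _ _ _ _ _ _ l1) => //.
- by rewrite /= !r1 // r2 r7 r8.
- by apply: (mem_links hn iN); rewrite !inE eqxx ?orbT.
move=> tau2 st2 l2 o2; apply: hQ; last exact: same_own_trans o1 o2.
by move: l2; rewrite -!cats1 -catA addnA.
Qed.

Lemma wp_row_loop (tri : nat -> bool) done rest B tau st
    (Q : nat -> state -> Prop) :
  reg st 2 = n -> reg st 7 = h -> query_input st -> reg st 1 = 0 ->
  (forall l r, l < n -> dist_answer directed N s t
       (foldl (next_graph md) E0 (done ++ iter_requests (row_requests md n h) 0 l ++
          (if md is Incremental then row_updates n h (clock md n l) else [::]))) r ->
     (r < bound n h (clock md n l)) = tri (clock md n l)) ->
  lv done (iter_requests (row_requests md n h) 0 n ++ rest) B tau st ->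
  (forall tau' st', lv (done ++ iter_requests (row_requests md n h) 0 n) rest
       (B + (n * (row_cost + 4) + 3)) tau' st' ->
     same_but [:: 5; 8; 9; 1] st st' ->
     reg st' 1 = has (fun l => u (clock md n l) && tri (clock md n l)) (iota 0 n) ->
     Q tau' st') ->
  wp w (for_loop 5 (row_body md D)) Q tau st.
Proof.
move=> r2 r7 inp r1 ans l hQ; set F := row_requests md n h.
pose g l := u (clock md n l) && tri (clock md n l).
pose J k B tau st := lv (done ++ iter_requests F 0 k) (iter_requests F k n ++ rest)
  B tau st /\ reg st 1 = has g (iota 0 k).
apply: (wp_for_budget (n := n) (J := J) (X := [:: 8; 9; 1]) (C := row_cost)
  (B := B)) => //.
- move=> k B1 tau1 st1 st2 x d [l1 g1] wr; split.
    exact: live_writes_reg l1 wr.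
  by case: wr => _ ->.
- by rewrite /J iter_requests_nil cats0.
- move=> k B1 tau1 st1 kn [l1 g1] r5 o1.
  have r21 : reg st1 2 = n by case: o1 => -> //.
  have [ck uk] : eval st1 (eclock md (EReg 5)) = clock md n k /\
      no_underflow st1 (eclock md (EReg 5)).
    by rewrite -r5; apply: eclock_eval; rewrite //= r5.
  have iN := clock_lt md kn.
  have fc : fits (eclock md (EReg 5)) by case: (md).
  have cc : cost (eclock md (EReg 5)) + 2 <= 10 by case: (md).
  apply: wp_seq; apply: wp_assign; rewrite ?ck //; first by move: nw; lia.
  move=> st2 wr2.
  have l2 := live_writes_reg (10) (isT : 8 < first_tmp) l1 wr2.
  have l2' : lv (done ++ iter_requests F 0 k) (iter_requests F k n ++ rest)
      (B1 + 10) (tau1 + (cost (eclock md (EReg 5)) + 2)) st2.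
    by case: l2 => sg [T [em sv tB]]; exists sg, T; split=> //; lia.
  have r2' y : y < first_tmp -> y != 8 -> reg st2 y = reg st1 y.
    by move=> yF y8; case: wr2 => _ ->; rewrite ?own_persistent // (negbTE y8).
  have r8 : reg st2 8 = clock md n k by case: wr2 => _ ->.
  have r22 : reg st2 2 = n by rewrite r2'.
  have r72 : reg st2 7 = h by rewrite r2' //; case: o1 => -> //.
  have r12 : reg st2 1 = has g (iota 0 k) by rewrite r2'.
  have inp2 : query_input st2.
    move=> j jn; case: wr2 => -> _; case: o1 => _ o1; rewrite !o1 //.
    exact: inp.
  have gS : has g (iota 0 k.+1) =
      has g (iota 0 k) || (u (clock md n k) && tri (clock md n k)).
    by rewrite -addn1 iotaD has_cat /= orbF.
  have ansk := ans k _ kn.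
  have o2 : same_but [:: 8; 9; 1] st1 st2.
    by apply: same_but_sub (writes_reg_but wr2) _ => y; rewrite !inE => ->.
  have sub91 : {subset [:: 9; 1] <= [:: 8; 9; 1]}.
    by move=> y; rewrite !inE => ->; rewrite orbT.
  rewrite /F (iter_requestsS _ kn) -/F -catA in l2'.
  move: l2'; move: (tau1 + _) => tau2 l2'.
  have [mdE|mdE] : md = Incremental \/ md = Decremental.
    by case: (md); [left|right].
  + have ifE T (x y : T) : (if md is Incremental then x else y) = x.
      by rewrite mdE.
    have rowE : F k = row_updates n h (clock md n k) ++ [:: Query].
      by rewrite /F /row_requests ifE cats1.
    rewrite rowE -catA in l2'; rewrite ifE.
    apply: wp_seq; apply: (wp_row_sends r22 r72 r8 iN l2') => tau3 st3 l3 o3.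
    have [r3 a3] := o3.
    apply: (wp_test_body (i := clock md n k) _ _ _ _ _ _ _ l3);
      rewrite ?r3 //.
    * by move=> j jn; rewrite !a3 //; apply: inp2.
    * exact: r12.
    * by move=> r; have := ansk r; rewrite ifE catA; apply.
    move=> tau4 st4 l4 o4 r4; split; last first.
      apply: same_but_trans o2 _ (fun _ h => h).
      exact: same_but_trans (same_own_but [:: 8; 9; 1] o3)
        (same_but_sub o4 sub91) (fun _ h => h).
    split; last by rewrite gS.
    move: l4; rewrite iter_requests_last // -/F rowE -!cats1 -!catA.
    by apply: live_mono; rewrite /row_cost; lia.
  + have ifE T (x y : T) : (if md is Incremental then x else y) = y.
      by rewrite mdE.
    have rowE : F k = Query :: row_updates n h (clock md n k).
      by rewrite /F /row_requests ifE.
    rewrite rowE in l2'; rewrite ifE.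
    apply: wp_seq; apply: (wp_test_body r22 r72 r8 iN inp2 r12 _ l2').
      by move=> r; have := ansk r; rewrite ifE cats0; apply.
    move=> tau3 st3 l3 o3 r13.
    have r3 y : y < first_tmp -> y != 9 -> y != 1 -> reg st3 y = reg st2 y.
      by move=> yF y9 y1; case: o3 => -> //; rewrite !inE negb_or y9.
    apply: (wp_row_sends (i := clock md n k) _ _ _ _ l3); rewrite ?r3 //.
    move=> tau4 st4 l4 o4; split; last first.
      apply: same_but_trans o2 _ (fun _ h => h).
      exact: same_but_trans (same_but_sub o3 sub91)
        (same_own_but [:: 8; 9; 1] o4) (fun _ h => h).
    split; last by rewrite gS; case: o4 => -> //.
    move: l4; rewrite iter_requests_last // -/F rowE -!cats1 -!catA.
    by apply: live_mono; rewrite /row_cost; lia.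
move=> tau1 st1 [l1 g1] o1; apply: hQ => //.
by move: l1; rewrite iter_requests_nil.
Qed.

Definition query_cost : nat :=
  mask_cost true + mask_cost false + row_cost + 100.

Lemma query_correct (tri : nat -> bool) qt done rest B tau st :
  reg st 2 = n -> reg st 3 = qt -> qt < n -> clock md n qt = h ->
  query_input st ->
  (forall l r, l < n -> dist_answer directed N s t
       (foldl (next_graph md) E0
          (done ++ iter_requests (mask_requests n h v z (is_dec md)) 0 n ++
           iter_requests (row_requests md n h) 0 l ++
          (if md is Incremental then row_updates n h (clock md n l) else [::]))) r ->
     (r < bound n h (clock md n l)) = tri (clock md n l)) ->
  lv done (query_requests md n h v z ++ rest) B tau st ->
  wp w (query_cmd md D) (fun tau' st' =>
    [/\ lv (done ++ query_requests md n h v z) rest (B + query_cost * n) tau' st',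
        reg st' 2 = n, reg st' 3 = qt.+1
      & reg st' 1 = has (fun l => u (clock md n l) && tri (clock md n l))
                      (iota 0 n)]) tau st.
Proof.
move=> r2 r3 qn qh inp ans l.
have [c7 u7] : eval st (eclock md (EReg 3)) = h /\
    no_underflow st (eclock md (EReg 3)).
  by rewrite -qh -r3; apply: eclock_eval; rewrite //= r3.
have fc : fits (eclock md (EReg 3)) by case: (md).
have cc : cost (eclock md (EReg 3)) + 2 <= 10 by case: (md).
apply: wp_seq; apply: wp_assign; rewrite ?c7 //; first by move: nw; lia.
move=> st1 wr1.
have l1' := live_writes_reg (10) (isT : 7 < first_tmp) l wr1.
have l1 : lv done (query_requests md n h v z ++ rest) (B + 10)
    (tau + (cost (eclock md (EReg 3)) + 2)) st1.
  by case: l1' => sg [T [em sv tB]]; exists sg, T; split=> //; lia.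
move: l1; move: (tau + _) => tau1 l1.
apply: wp_seq; apply: wp_assign => // [|st2 wr2]; first by rewrite /= expn_gt0.
have l2 := live_writes_reg (cost (ENat 0) + 2) (isT : 1 < first_tmp) l1 wr2.
have r2' y : y < first_tmp -> y != 7 -> y != 1 -> reg st2 y = reg st y.
  move=> yF y7 y1; case: wr2 => _ ->; rewrite ?own_persistent // (negbTE y1).
  by case: wr1 => _ ->; rewrite ?own_persistent // (negbTE y7).
have r22 : reg st2 2 = n by rewrite r2'.
have r72 : reg st2 7 = h.
  by case: wr2 => _ -> //=; case: wr1 => _ -> //.
have r12 : reg st2 1 = 0 by case: wr2 => _ ->.
have inp2 : query_input st2.
  by move=> j jn; case: wr2 => -> _; case: wr1 => -> _; apply: inp.
rewrite /query_requests -!catA in l2.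
apply: wp_seq; apply: (wp_mask_loop r22 r72 inp2 l2) => tau3 st3 l3 o3.
have inp3 : query_input st3.
  by move=> j jn; case: o3 => _ o3; rewrite !o3 //; apply: inp2.
have r23 : reg st3 2 = n by case: o3 => -> //.
have r73 : reg st3 7 = h by case: o3 => -> //.
have r13 : reg st3 1 = 0 by case: o3 => -> //.
apply: wp_seq; apply: (wp_row_loop r23 r73 inp3 r13 _ l3).
  by move=> k r kn; rewrite -catA; apply: ans.
move=> tau4 st4 l4 o4 r14.
have inp4 : query_input st4.
  by move=> j jn; case: o4 => _ o4; rewrite !o4 //; apply: inp3.
have r24 : reg st4 2 = n by case: o4 => -> //.
have r74 : reg st4 7 = h by case: o4 => -> //.
apply: wp_seq; apply: (wp_mask_loop r24 r74 inp4 l4) => tau5 st5 l5 o5.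
have r35 : reg st5 3 = qt.
  by case: o5 => -> //; case: o4 => -> //; case: o3 => -> //; rewrite r2'.
have e3 : eval st5 (EAdd (EReg 3) (ENat 1)) = qt.+1 by rewrite /= r35 addn1.
apply: wp_assign; rewrite ?e3 //; first by move: nw; lia.
move=> st6 wr6.
have l6 := live_writes_reg (cost (EAdd (EReg 3) (ENat 1)) + 2)
  (isT : 3 < first_tmp) l5 wr6.
split.
- move: l6; rewrite /query_requests -!catA; apply: live_mono.
  rewrite [cost (ENat 0)]/= [cost (EAdd _ _)]/=.
  (* The two mask loops use both values of the bit, in an order that depends on the mode. *)
  have -> : query_cost = mask_cost (is_dec md) + mask_cost (~~ is_dec md) +
      row_cost + 100.
    by rewrite /query_cost; case: (md) => //=; rewrite [mask_cost false + _]addnC.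
  move: (mask_cost (is_dec md)) (mask_cost (~~ is_dec md)) row_cost => c1 c2 c3.
  by rewrite !mulnDl !mulnDr ![_ * n]mulnC; lia.
- by case: wr6 => _ -> //=; case: o5 => -> //.
- by case: wr6 => _ ->.
- by case: wr6 => _ -> //=; case: o5 => -> //.
Qed.

End Query.

(** * From OMv3 inputs to functions on natural numbers *)

Definition row_fun (n : nat) (x : 'rV[bool]_n) (j : nat) : bool :=
  if insub j is Some i then x ord0 i else false.

Definition mat_fun (n : nat) (A : 'M[bool]_n) (i j : nat) : bool :=
  if insub i is Some i' then row_fun (row i' A) j else false.

Lemma row_funE n (x : 'rV[bool]_n) (j : 'I_n) : row_fun x j = x ord0 j.
Proof. by rewrite /row_fun valK. Qed.

Lemma mat_funE n (A : 'M[bool]_n) (i j : 'I_n) : mat_fun A i j = A i j.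
Proof. by rewrite /mat_fun valK row_funE mxE. Qed.

Lemma size_vector_words n (x : 'rV[bool]_n) : size (vector_words x) = n.
Proof. by rewrite size_map size_enum_ord. Qed.

Lemma nth_vector_words n (x : 'rV[bool]_n) j : j < n ->
  nth 0 (vector_words x) j = row_fun x j.
Proof.
move=> jn; rewrite (nth_map (Ordinal jn)) ?size_enum_ord //.
by rewrite (nth_ord_enum _ (Ordinal jn)) -row_funE.
Qed.

Lemma nth_allpairs (S T R : Type) (f : S -> T -> R) s0 t0 r0 s t i j :
  i < size s -> j < size t ->
  nth r0 [seq f x y | x <- s, y <- t] (i * size t + j) =
  f (nth s0 s i) (nth t0 t j).
Proof.
elim: s i => //= x s IH [|i] /= il jl; rewrite nth_cat size_map.
  by rewrite mul0n jl (nth_map t0).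
by rewrite ifN -?leqNgt ?mulSn -?addnA ?leq_addr // addKn IH.
Qed.

Lemma nth_matrix_words n (A : 'M[bool]_n) x j : x < n -> j < n ->
  nth 0 (matrix_words A) (1 + (x * n + j)) = mat_fun A x j.
Proof.
move=> xn jn; have := nth_allpairs (fun i j => nat_of_bool (A i j))
  (Ordinal xn) (Ordinal jn) 0 (s := enum 'I_n) (t := enum 'I_n) (i := x) (j := j).
rewrite !size_enum_ord => /(_ xn jn) /= ->.
by rewrite (nth_ord_enum _ (Ordinal xn)) (nth_ord_enum _ (Ordinal jn)) -mat_funE.
Qed.

Lemma size_matrix_words n (A : 'M[bool]_n) :
  size (matrix_words A) = (n * n).+1.
Proof. by rewrite /= size_allpairs !size_enum_ord. Qed.

(** The rows are tested in the order of [clock], which is an involution on the indices below [n], so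
    the disjunction over all rows is unaffected. *)
Lemma omv3_answerE md n (A : 'M[bool]_n) (u v z : 'rV[bool]_n) :
  omv3_answer A (u, v, z) =
  has (fun l => row_fun u (clock md n l) &&
    triangle_at (mat_fun A) n (row_fun v) (row_fun z) (clock md n l)) (iota 0 n).
Proof.
apply/existsP/hasP => [[i /existsP[j /existsP[k]]]|[l]].
  case/and5P=> ui vj zk Aij /andP[Ajk Aki].
  exists (clock md n i); rewrite ?mem_iota0 ?clock_lt //.
  rewrite clockK // row_funE ui; apply/hasP; exists (k : nat).
    by rewrite mem_iota0.
  rewrite row_funE zk mat_funE Aki !andbT; apply/hasP; exists (j : nat).
    by rewrite mem_iota0.
  by rewrite !mat_funE row_funE Aij vj Ajk.
rewrite mem_iota0 => /(clock_lt md); move: (clock md n l) => i iN.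
rewrite -[i]/(val (Ordinal iN)) row_funE => /andP[ui /hasP[k]].
rewrite mem_iota0 => kn; rewrite -[k]/(val (Ordinal kn)) row_funE mat_funE.
case/andP=> /andP[/hasP[j]]; rewrite mem_iota0 => jn.
rewrite -[j]/(val (Ordinal jn)) row_funE !mat_funE => /and3P[Aij vj Ajk] zk Aki.
exists (Ordinal iN); apply/existsP; exists (Ordinal jn); apply/existsP.
by exists (Ordinal kn); apply/and5P; split=> //; apply/andP.
Qed.

Definition masks (n : nat) (q : omv3_query n) : (nat -> bool) * (nat -> bool) :=
  (row_fun q.1.2, row_fun q.2).

Lemma arr_with_input w inp st j : j < size inp ->
  arr (with_input w inp st) 0 j = wrap w (nth 0 inp j).
Proof. by move=> jn; rewrite /= jn. Qed.

Lemma query_input_words w n (q : omv3_query n) st : 0 < w ->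
  query_input n (row_fun q.1.1) (row_fun q.1.2) (row_fun q.2)
    (with_input w (omv3_words q) st).
Proof.
case: q => [[u v] z] w0 j jn /=.
have wb (b : bool) : wrap w b = b.
  by rewrite /wrap modn_small //; have := word_gt1 w0; case: b; lia.
rewrite !size_cat !size_vector_words.
have -> : j < n + (n + n) by lia.
have -> : n + j < n + (n + n) by lia.
have -> : n + n + j < n + (n + n) by lia.
have skip (s1 s2 : seq nat) i : size s1 = n -> nth 0 (s1 ++ s2) (n + i) = nth 0 s2 i.
  by move=> sz; rewrite nth_cat sz ltnNge leq_addr addKn.
rewrite -addnA !skip ?size_vector_words // !nth_cat !size_vector_words jn.
by rewrite !nth_vector_words // !wb.
Qed.

(** * The online sequence and the final time bounds *)

(** Induction on the queries still to come. Besides [query_cost * n], each call pays [3 * n + 1]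
    steps, at most [4 * n], for receiving three vectors. *)
Lemma serves_queries directed md D w n (A : 'M[bool]_n) qs1 qs2 B st :
  0 < n -> wide w n -> size (qs1 ++ qs2) = n ->
  reg st 2 = n -> reg st 3 = size qs1 ->
  live directed md D w (num_vertices n) 0 (off 4 10 n)
    (initial_edges md (mat_fun A) n)
    (all_requests md n 0 [seq masks q | q <- qs1])
    (all_requests md n (size qs1) [seq masks q | q <- qs2]) B 0 st ->
  exists2 T, serves w (fun=> query_cmd md D) (@omv3_words n) (fun A' _ => A')
      (fun A' q r => r = omv3_answer A' q) A qs2 st T
    & T <= B + size qs2 * ((query_cost + 4) * n).
Proof.
move=> n0 wd; elim: qs2 qs1 B st => [|q qs2 IH] qs1 B st sq r2 r3 l.
  by exists 0; first exact: serves_nil.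
have qn : size qs1 < n by move: sq; rewrite size_cat /=; lia.
set h := clock md n (size qs1).
have hn : h < n by exact: clock_lt.
set st1 := with_input w (omv3_words q) st.
have l1 : live directed md D w (num_vertices n) 0 (off 4 10 n)
    (initial_edges md (mat_fun A) n)
    (all_requests md n 0 [seq masks q | q <- qs1])
    (query_requests md n h (row_fun q.1.2) (row_fun q.2) ++
     all_requests md n (size qs1).+1 [seq masks q | q <- qs2]) B 0 st1.
  have [sg [T [[er ea] sv TB]]] := l; exists sg, T; split=> //.
  split=> [x|a i] /=; first by rewrite shifted_neq.
  have -> : (a + arr_shift == 0) = false by rewrite /arr_shift; lia.
  exact: ea.
have inp : query_input n (row_fun q.1.1) (row_fun q.1.2) (row_fun q.2) st1.
  exact: query_input_words (wide_word wd).
have r21 : reg st1 2 = n by [].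
have r31 : reg st1 3 = size qs1 by [].
pose tri := triangle_at (mat_fun A) n (row_fun q.1.2) (row_fun q.2).
have sq' : size ([seq masks q | q <- qs1] ++ masks q :: [seq masks q | q <- qs2]) = n.
  by move: sq; rewrite !size_cat /= !size_map.
have [|t [st2 [run [l2 n2 t2 a2]]]] :=
  query_correct n0 wd hn (tri := tri) r21 r31 qn erefl inp _ l1.
  move=> k r kn; have := test_answer (directed := directed) (md := md)
    (A := mat_fun A) (r := r) sq' kn.
  by rewrite size_map -/h; apply.
rewrite add0n in l2.
(* Elapsed time restarts at 0 with the next call, so the time [t] of this call is taken off the
   budget. *)
have [||||T sv TB] := IH (rcons qs1 q) (B + query_cost * n - t) st2.
- by rewrite cat_rcons.
- exact: n2.
- by rewrite size_rcons.
- have [sg [T [em sv TB]]] := l2; exists sg, T; split=> //; last by lia.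
  rewrite size_rcons map_rcons -cats1 all_requests_cat size_map /= cats0.
  exact: sv.
exists ((size (omv3_words q)).+1 + t + T).
  apply: (serves_cons (st' := st2)) sv; first by exists t.
  by rewrite /output a2 /tri; case: (q) => [[u v] z]; rewrite (omv3_answerE md).
have [sg [T2 [_ _ T2B]]] := l2.
have -> : size (omv3_words q) = 3 * n.
  by case: (q) => [[u v] z]; rewrite /= !size_cat !size_vector_words; lia.
move: TB; rewrite -[size (q :: qs2)]/(size qs2).+1 [_.+1 * (_ * n)]mulSn.
move: (size qs2 * _) => d; rewrite [(query_cost + 4) * n]mulnDl.
by move: (query_cost * n) T2B => c; lia.
Qed.

Lemma serves_pos (A Q : Type) w proc enc next ok (a : A) (q : Q) qs st T :
  serves w proc enc next ok a (q :: qs) st T -> 0 < T.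
Proof. by move=> sv; inversion sv as [|? ? ? ? ? ? ? [t' -> _]]; subst. Qed.

(** As [n] is positive, [(n + 2) ^ 6] is at least 729, so [(n + 2) ^ 8] dominates
    [100 * (n * n) + 100] and hence [num_edges n + 2]. The exponent [8 * k] serves the simulated
    algorithm; taking [k.+1] gives [wide] for [k = 0] as well. *)
Lemma wide_pow w n k : 0 < n -> (n + 2) ^ (8 * k.+1) <= 2 ^ w ->
  wide w n /\ (num_edges n + 2) ^ k <= 2 ^ w.
Proof.
move=> n0 hw.
have base : 100 * (n * n) + 100 <= (n + 2) ^ 8.
  have n2 : n * n + 4 <= (n + 2) ^ 2 by rewrite expnS expn1; nia.
  have n6 : 3 ^ 6 <= (n + 2) ^ 6 by rewrite leq_exp2r // addn2.
  have := leq_mul n2 n6; rewrite -expnD; apply: leq_trans.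
  by have -> : 3 ^ 6 = 729 by []; lia.
split.
  apply: leq_trans base _; apply: leq_trans hw.
  by rewrite leq_exp2l ?addn2 // leq_pmulr.
have le : num_edges n + 2 <= (n + 2) ^ 8.
  by apply: leq_trans base; rewrite /num_edges /off; nia.
apply: leq_trans hw; rewrite expnM.
apply: (@leq_trans (((n + 2) ^ 8) ^ k)).
  by case: k => [|k]; rewrite ?expn0 // leq_exp2r.
by rewrite leq_pexp2l // expn_gt0 addn2.
Qed.

Theorem theorem8 (directed : bool) (md : mode) (P u : nat -> nat)
    (hSP : maintains_stSP directed md P u) :
  exists f : nat -> nat,
    (exists C : nat, forall n : nat, f n <= C * n ^ 2) /\
    solves_OMv3 (fun n => P (f n)) (fun n => n ^ 2 * u (f n)).
Proof.
exists num_edges; split.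
  by exists 16 => n; rewrite /num_edges /off -mulnn; nia.
have [D [k [c spec]]] := hSP.
exists (prep_cmd md D), (query_cmd md D), (8 * k.+1).
(* One constant has to serve both bounds: the first summand is for the preprocessing, the second for
   the queries. *)
exists ((prep_cost + 4) * c + (23 * c + query_cost + 4)).
move=> w n A qs n0 hw sq; have [wd hwD] := wide_pow n0 hw.
set reqs := all_requests md n 0 [seq masks q | q <- qs].
have sq' : size [seq masks q | q <- qs] = n by rewrite size_map.
have inst := schedule_instance directed md (mat_fun A) n0 sq'.
(* The proof knows all queries beforehand, the program does not: it issues each request only when
   the query that determines it has arrived. *)
have [tp [T [sg [cal tpP sv TP]]]] := spec w _ _ _ _ _ _ hwD inst.
have w0 := wide_word wd; have w1 := word_gt1 w0.
set st0 := with_input w (matrix_words A) state0.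
have sA := size_matrix_words A.
have nn1 : 0 < n * n by rewrite muln_gt0 n0.
have bs : (n * n).+1 < 2 ^ w by move: wd; rewrite /wide; lia.
have [] := prep_correct n0 wd cal (st := st0).
- split=> [|a j|x] /=; rewrite ?shifted_neq //.
  have -> : (a + arr_shift == 0) = false by rewrite /arr_shift; lia.
  by rewrite nth_nil if_same.
- by rewrite /= /wrap modn_small //; nia.
- move=> x j xn jn.
  rewrite arr_with_input; last by rewrite sA ltnS cell_lt.
  by rewrite nth_matrix_words // /wrap modn_small //; case: (mat_fun A x j); lia.
move=> t [st [run em r2 r3 tle]].
have [] := serves_queries (directed := directed) (md := md) (D := D) (A := A)
  (qs1 := [::]) (qs2 := qs) (B := T) (st := st) n0 wd sq r2 r3.
  by exists sg, T.
move=> T' sv' TB'.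
exists ((size (matrix_words A)).+1 + t), T', st; split=> //.
- by exists t.
- have tpn : n * n + 2 <= tp.
    case: cal => t' -> _; rewrite size_cat /= -[flatten _]/(words_of _).
    rewrite size_words_of; have : off 7 3 n <= size (initial_edges md (mat_fun A) n).
      rewrite -(size_fixed_edges (mat_fun A)) /initial_edges; case: (md) => //.
      by rewrite [size (_ ++ links n)]size_cat leq_addr.
    by rewrite /off; lia.
  rewrite sA mulnDl; apply: leq_trans (leq_addr _ _).
  have : (prep_cost + 4) * tp <= (prep_cost + 4) * c * P (num_edges n).
    by rewrite -mulnA leq_mul2l tpP orbT.
  apply: leq_trans; rewrite mulnDl.
  have : prep_cost * (n * n) <= prep_cost * tp by rewrite leq_mul2l; lia.
  by move: tle; move: (prep_cost * _) (prep_cost * _) => a b; lia.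
(* Otherwise a nonempty sequence of requests would be served in time 0, although every call takes at
   least one step. *)
have u0 : 0 < u (num_edges n).
  rewrite lt0n; apply/eqP => uz; move: TP sv; rewrite uz !muln0 leqn0 => /eqP->.
  have : 0 < size reqs by rewrite size_all_requests sq'; lia.
  by rewrite -/reqs; case: reqs => // q r _ sv0; have := serves_pos sv0.
rewrite mulnDl; apply: leq_trans (leq_addl _ _).
move: TP; rewrite size_all_requests sq' => TP.
(* There are [13 * n * n + 3 * n] edges and [7 * n] requests per query: four mask updates, two row
   updates and one distance query for each index. The sum is at most [23 * n * n]. *)
have : (num_edges n + n * (7 * n)) * u (num_edges n) <=
    23 * (n ^ 2 * u (num_edges n)).
  rewrite [23 * _]mulnA leq_mul2r -mulnn; apply/orP; right.
  by rewrite /num_edges /off; nia.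
move=> le23.
have lec : c * ((num_edges n + n * (7 * n)) * u (num_edges n)) <=
    23 * c * (n ^ 2 * u (num_edges n)).
  by rewrite [23 * c]mulnC -mulnA leq_mul2l le23 orbT.
have leq : n * ((query_cost + 4) * n) <= (query_cost + 4) * (n ^ 2 * u (num_edges n)).
  by rewrite mulnCA -mulnn leq_mul2l leq_pmulr ?orbT.
rewrite sq in TB'; rewrite -addnA mulnDl.
apply: leq_trans TB' _; apply: leq_add leq.
exact: leq_trans TP lec.
Qed.
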